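(* Let $\mathcal{A}$ be a free arrangement of planes through the origin in $\mathbb{C}^3$ with exponents $(1,e_1,e_2)$, let $H_0\in\mathcal{A}$, and let $\mathbf{d}_{H_0}\mathcal{A}$ be the deconing, an arrangement of affine lines in $\mathbb{C}^2$. Let $L_2(\mathcal{A})=\{L\cap L'\in\mathbb{C}^2\mid L,L'\in\mathbf{d}_{H_0}\mathcal{A},\ L\neq L'\}$ be the set of intersection points of these lines, and for $p\in L_2(\mathcal{A})$ put $\mu(p)=\sharp\{L\in\mathbf{d}_{H_0}\mathcal{A}\mid L\ni p\}-1$. Then there exist plane curves $C_1,C_2\subset\mathbb{C}^2$ of degrees $e_1$ and $e_2$ respectively such that $C_1\cap C_2=L_2(\mathcal{A})$ and, for every $p\in L_2(\mathcal{A})$, the intersection multiplicity of $C_1$ and $C_2$ at $p$ is $$\operatorname{mult}_p(C_1,C_2)=\mu(p).$$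
   Context: Let $S=\mathbb{C}[z_0,z_1,z_2]$ and, for each $H\in\mathcal{A}$, fix a linear form $\alpha_H$ with $H=\alpha_H^{-1}(0)$. $D(\mathcal{A})=\{\delta\in\operatorname{Der}_S\mid\delta\alpha_H\in(\alpha_H)\ \forall H\in\mathcal{A}\}$. $\mathcal{A}$ is free with exponents $(d_1,d_2,d_3)$ if $D(\mathcal{A})$ is a free $S$-module with a homogeneous basis $\delta_1,\delta_2,\delta_3$ with $\deg\delta_i=d_i$, where $\deg\delta$ is the polynomial degree of the coefficients of $\delta$. Deconing: choose linear coordinates $(z_0,z_1,z_2)$ with $H_0=\{z_0=0\}$; then $\mathbf{d}_{H_0}\mathcal{A}$ is the set of affine lines $H\cap\{z_0=1\}$, $H\in\mathcal{A}\setminus\{H_0\}$, in $\{z_0=1\}\cong\mathbb{C}^2$. A plane curve of degree $e$ is the zero locus $C=\{f=0\}\subset\mathbb{C}^2$ attached to a polynomial $f$ of degree $e$ (not necessarily irreducible or reduced; for $e=0$, $f$ is a nonzero constant and $C$ is empty). For $C_i=\{f_i=0\}$ the intersection multiplicity at $p$ is $\operatorname{mult}_p(C_1,C_2)=\dim_{\mathbb{C}}\widehat{\mathcal{O}}_{\mathbb{C}^2,p}/(f_1,f_2)$, where $\widehat{\mathcal{O}}_{\mathbb{C}^2,p}$ is the formal power series ring at $p$. *)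

(* Defs.v *)
From HB Require Import structures.
From mathcomp Require Import all_boot all_order all_algebra finmap mpoly complex.
From mathcomp Require Import boolp classical_sets reals.

Set Implicit Arguments.
Unset Strict Implicit.
Unset Printing Implicit Defensive.

Import GRing.Theory.
Local Open Scope classical_set_scope.
Local Open Scope ring_scope.

(* Formal power series in n variables, indexed by exponent vectors.  The
   product formula is the one of [mcoeffM]: the bounds on the degrees of k.1
   and k.2 only serve to make the index type of the sum finite. *)

Record mpowser (n : nat) (R : Type) := MPowser { pscoeff : 'X_{1..n} -> R }.

Section PowerSeriesRing.
Context {n : nat} {R : comNzRingType}.
Local Notation ps := (mpowser n R).
Implicit Types f g h : ps.

HB.instance Definition _ := gen_eqMixin ps.
HB.instance Definition _ := gen_choiceMixin ps.

Lemma mpowserP f g : (forall m, pscoeff f m = pscoeff g m) -> f = g.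
Proof. by case: f g => [f] [g] /= /funext ->. Qed.

Definition ps_zero : ps := MPowser (fun=> 0).
Definition ps_one : ps := MPowser (fun m => (m == 0%MM)%:R).
Definition ps_opp f : ps := MPowser (fun m => - pscoeff f m).
Definition ps_add f g : ps := MPowser (fun m => pscoeff f m + pscoeff g m).
Definition ps_scale (a : R) f : ps := MPowser (fun m => a * pscoeff f m).
Definition ps_mul f g : ps := MPowser (fun m =>
  \sum_(k : 'X_{1..n < (mdeg m).+1, (mdeg m).+1} | m == (k.1 + k.2)%MM)
    pscoeff f k.1 * pscoeff g k.2).

Definition ps_of_mpoly (p : {mpoly R[n]}) : ps := MPowser (fun m => p@_m).

Fact ps_addA : associative ps_add.
Proof. by move=> f g h; apply: mpowserP => m /=; rewrite addrA. Qed.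
Fact ps_addC : commutative ps_add.
Proof. by move=> f g; apply: mpowserP => m /=; rewrite addrC. Qed.
Fact ps_add0 : left_id ps_zero ps_add.
Proof. by move=> f; apply: mpowserP => m /=; rewrite add0r. Qed.
Fact ps_addN : left_inverse ps_zero ps_opp ps_add.
Proof. by move=> f; apply: mpowserP => m /=; rewrite addNr. Qed.

HB.instance Definition _ :=
  GRing.isZmodule.Build ps ps_addA ps_addC ps_add0 ps_addN.

(* The ring axioms are reduced to those of {mpoly R[n]} by truncation. *)

Definition ps_trunc (d : nat) f : {mpoly R[n]} :=
  \sum_(k : 'X_{1..n < d.+1}) pscoeff f k *: 'X_[k].

Lemma ps_truncE d f m : (mdeg m <= d)%N -> (ps_trunc d f)@_m = pscoeff f m.
Proof.
move=> lemd; have ltmd : (mdeg m < d.+1)%N by [].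
rewrite /ps_trunc raddf_sum /= (bigD1 (BMultinom ltmd)) //= mcoeffZ mcoeffX eqxx.
rewrite mulr1 big1 ?addr0 // => k /negP neq; rewrite mcoeffZ mcoeffX.
by case: eqP => [e|_]; rewrite ?mulr0 //; case: neq; apply/eqP/val_inj.
Qed.

Lemma ps_mulE f g m (p q : {mpoly R[n]}) :
    (forall k, (mdeg k <= mdeg m)%N -> p@_k = pscoeff f k) ->
    (forall k, (mdeg k <= mdeg m)%N -> q@_k = pscoeff g k) ->
  pscoeff (ps_mul f g) m = (p * q)@_m.
Proof.
move=> ep eq; rewrite mcoeffM /=; apply: eq_bigr => -[[k1 h1] [k2 h2]] _ /=.
by rewrite ep // eq.
Qed.

Lemma ps_truncM d f g m : (mdeg m <= d)%N ->
  (ps_trunc d f * ps_trunc d g)@_m = pscoeff (ps_mul f g) m.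
Proof.
by move=> led; symmetry; apply: ps_mulE => k lek;
  rewrite ps_truncE // (leq_trans lek).
Qed.

Fact ps_mulA : associative ps_mul.
Proof.
move=> f g h; apply: mpowserP => m; set d := mdeg m.
pose t := ps_trunc d.
have -> : pscoeff (ps_mul f (ps_mul g h)) m = (t f * (t g * t h))@_m.
  by apply: ps_mulE => k lek; [rewrite /t ps_truncE | rewrite /t ps_truncM].
rewrite mulrA; symmetry.
by apply: ps_mulE => k lek; [rewrite /t ps_truncM | rewrite /t ps_truncE].
Qed.

Fact ps_mulC : commutative ps_mul.
Proof.
move=> f g; apply: mpowserP => m.
by rewrite -!(@ps_truncM (mdeg m)) // mulrC.
Qed.

Fact ps_mul1 : left_id ps_one ps_mul.
Proof.
move=> f; apply: mpowserP => m.
have -> : pscoeff (ps_mul ps_one f) m = (1 * ps_trunc (mdeg m) f)@_m.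
  by apply: ps_mulE => k lek; [rewrite mcoeff1 | rewrite ps_truncE].
by rewrite mul1r ps_truncE.
Qed.

Fact ps_mulDl : left_distributive ps_mul ps_add.
Proof.
move=> f g h; apply: mpowserP => m /=; rewrite -big_split /=.
by apply: eq_bigr => k _; rewrite mulrDl.
Qed.

Fact ps_one_neq0 : ps_one != 0 :> ps.
Proof.
apply/eqP => /(congr1 (fun f => pscoeff f 0%MM)) /= /eqP.
by rewrite eqxx oner_eq0.
Qed.

HB.instance Definition _ := GRing.Zmodule_isComNzRing.Build ps
  ps_mulA ps_mulC ps_mul1 ps_mulDl ps_one_neq0.

Fact ps_scaleA a b f : ps_scale a (ps_scale b f) = ps_scale (a * b) f.
Proof. by apply: mpowserP => m /=; rewrite mulrA. Qed.
Fact ps_scale1 : left_id 1 ps_scale.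
Proof. by move=> f; apply: mpowserP => m /=; rewrite mul1r. Qed.
Fact ps_scaleDr : right_distributive ps_scale +%R.
Proof. by move=> a f g; apply: mpowserP => m /=; rewrite mulrDr. Qed.
Fact ps_scaleDl f : {morph ps_scale^~ f : a b / a + b}.
Proof. by move=> a b; apply: mpowserP => m /=; rewrite mulrDl. Qed.

HB.instance Definition _ := GRing.Zmodule_isLmodule.Build R ps
  ps_scaleA ps_scale1 ps_scaleDr ps_scaleDl.

End PowerSeriesRing.

(* dim_K (V / I) = n: the classes of some n vectors form a basis of V / I. *)
Definition quotient_dim (K : fieldType) (V : lmodType K) (I : set V) (n : nat) :=
  exists b : 'I_n -> V, forall v : V,
    exists! c : 'rV[K]_n, I (v - \sum_i c 0 i *: b i).

Section PlaneCurves.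
Variable K : fieldType.

Definition zero_locus (n : nat) (f : {mpoly K[n]}) : set 'rV[K]_n :=
  [set p | f.@[p 0] = 0].

(* The image of f in the completed local ring at p, identified with
   K[[x_0, ..., x_{n-1}]] through the coordinates centred at p. *)
Definition germ (n : nat) (p : 'rV[K]_n) (f : {mpoly K[n]}) : mpowser n K :=
  ps_of_mpoly (f \mPo [tuple 'X_i + (p 0 i)%:MP | i < n]).

Definition ideal2 (T : comNzRingType) (f g : T) : set T :=
  [set h | exists u v, h = u * f + v * g].

Definition intersection_mult_is (p : 'rV[K]_2) (f g : {mpoly K[2]}) (n : nat) :=
  quotient_dim (ideal2 (germ p f) (germ p g)) n.

End PlaneCurves.

Section LogarithmicDerivations.
Variables (K : fieldType) (n : nat).
Local Notation S := {mpoly K[n]}.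
Local Notation V := 'rV[K]_n.
Implicit Types (A : {fset {vspace V}}) (alpha : {vspace V} -> S) (d : S -> S).

Definition derivation d := linear d /\ forall f g, d (f * g) = d f * g + f * d g.

Definition derivation_homog (e : nat) d := forall i, d 'X_i \is e.-homog.

Definition defining_form (H : {vspace V}) (a : S) :=
  a \is 1.-homog /\ zero_locus a = [set v | v \in H].

Definition log_derivation A alpha : set (S -> S) :=
  [set d | derivation d /\
    forall H, H \in A -> exists g, d (alpha H) = g * alpha H].

(* Existence in [exists!] says that delta spans D; uniqueness, that it is
   linearly independent over S (recall that 0 is in D(A)). *)
Definition is_basis (D : set (S -> S)) (r : nat) (delta : 'I_r -> S -> S) :=
  (forall i, D (delta i)) /\
  forall d, D d -> exists! c : 'rV[S]_r, forall f, d f = \sum_i c 0 i * delta i f.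

Definition free_with_exponents A alpha (r : nat) (e : r.-tuple nat) :=
  exists delta : 'I_r -> S -> S,
    is_basis (log_derivation A alpha) delta /\
    forall i, derivation_homog (tnth e i) (delta i).

End LogarithmicDerivations.

Section Deconing.
Variable K : fieldType.
Implicit Types (A : {fset {vspace 'rV[K]_3}}) (H : {vspace 'rV[K]_3}).

(* An invertible matrix Z encodes the linear coordinates
   z_j(v) = (v *m Z) 0 j; a point u of the affine plane stands for the point
   of {z_0 = 1} with coordinates (1, u). *)

Definition adapted_coordinates H (Z : 'M[K]_3) :=
  Z \in unitmx /\ forall v : 'rV_3, (v \in H) = ((v *m Z) 0 0 == 0).

Definition affine_trace (Z : 'M[K]_3) H : set 'rV[K]_2 :=
  [set u | exists2 v : 'rV_3, v \in H & v *m Z = row_mx (const_mx 1 : 'rV_1) u].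

Definition decone (Z : 'M[K]_3) A H0 : {fset (set 'rV[K]_2)} :=
  [fset affine_trace Z H | H in (A `\ H0)%fset]%fset.

Definition intersection_points (L : {fset (set 'rV[K]_2)}) : set 'rV[K]_2 :=
  [set p | exists l l', [/\ l \in L, l' \in L, l != l' & l `&` l' = [set p]]].

Definition mu (L : {fset (set 'rV[K]_2)}) (p : 'rV[K]_2) : nat :=
  (#|` [fset l in L | p \in l]%fset| - 1)%N.

End Deconing.

(* Main.v *)
Require Import Defs.
From HB Require Import structures.
From mathcomp Require Import all_boot all_order all_algebra finmap mpoly complex.
From mathcomp Require Import boolp classical_sets reals.
From mathcomp Require Import ring.

(* The logarithmic derivations killing z_0 form a free module on two homogeneous
   fields theta_1, theta_2 of degrees e_1, e_2.  Dehomogenize them to planar fields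
   (P_i, Q_i) tangent to all the lines, and put f_i = P_i + b Q_i with b generic.

   Every logarithmic field (P, Q) is a combination of the two, so P + b Q lies in the
   ideal (f_1, f_2).  Let p lie on k lines, and write x, y for the coordinates
   centred at p.  Up to factors nonzero at p, the field (x, y) gives x + b y in the
   ideal, and the field along one of the lines times the forms of the others gives an
   element which is congruent to a nonzero multiple of y^(k-1).  Conversely, y P - x Q
   vanishes on the k lines, so its order along x + b y = 0 is at least k, and that of
   P + b Q at least k-1.  Hence the multiplicity is k-1.  The same fields show that
   f_1 and f_2 have no common zero on fewer than two lines. *)

Set Implicit Arguments.
Unset Strict Implicit.
Unset Printing Implicit Defensive.

Import GRing.Theory.
Local Open Scope classical_set_scope.
Local Open Scope ring_scope.

(** * Formal power series and ideals with two generators *)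

Section PowerSeries.
Context {n : nat} {K : fieldType}.
Implicit Types (p q : {mpoly K[n]}) (f g : mpowser n K).

Lemma ps_of_mpolyD p q : ps_of_mpoly (p + q) = ps_of_mpoly p + ps_of_mpoly q.
Proof. by apply: mpowserP => m /=; rewrite mcoeffD. Qed.

Lemma ps_of_mpolyM p q : ps_of_mpoly (p * q) = ps_of_mpoly p * ps_of_mpoly q.
Proof. by apply: mpowserP => m; rewrite (@ps_mulE _ _ _ _ _ p q). Qed.

Lemma ps_of_mpolyN p : ps_of_mpoly (- p) = - ps_of_mpoly p.
Proof. by apply: mpowserP => m /=; rewrite mcoeffN. Qed.

Lemma ps_of_mpoly1 : ps_of_mpoly (1 : {mpoly K[n]}) = 1.
Proof. by apply: mpowserP => m /=; rewrite mcoeff1. Qed.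

Lemma ps_of_mpoly0 : ps_of_mpoly (0 : {mpoly K[n]}) = 0.
Proof. by apply: mpowserP => m /=; rewrite mcoeff0. Qed.

Lemma ps_of_mpolyZ a p : ps_of_mpoly (a *: p) = a *: ps_of_mpoly p.
Proof. by apply: mpowserP => m /=; rewrite mcoeffZ. Qed.

Lemma ps_scaleE a f : a *: f = ps_of_mpoly a%:MP * f.
Proof.
apply: mpowserP => m; rewrite (@ps_mulE _ _ _ _ _ a%:MP (ps_trunc (mdeg m) f)) //.
  by rewrite mul_mpolyC mcoeffZ ps_truncE.
by move=> k lek; rewrite ps_truncE.
Qed.

Lemma mcoeff_mulX k p m :
  ('X_[k] * p)@_m = if (k <= m)%MM then p@_(m - k)%MM else 0.
Proof.
rewrite mulrC; case: ifP => [le_km|]; first by rewrite -{1}(submK le_km) addmC mcoeffMX.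
move/negbT; apply: contraNeq => nz.
have : m \in msupp (p * 'X_[k]) by rewrite mcoeff_msupp.
by rewrite (perm_mem (msuppMX p k)) => /mapP [m2 _ ->]; rewrite lem_addr.
Qed.

Lemma pscoeff_mulX k f m :
  pscoeff (ps_of_mpoly 'X_[k] * f) m
  = if (k <= m)%MM then pscoeff f (m - k)%MM else 0.
Proof.
rewrite (@ps_mulE _ _ _ _ _ 'X_[k] (ps_trunc (mdeg m) f)) //; last first.
  by move=> l lel; rewrite ps_truncE.
rewrite mcoeff_mulX; case: ifP => // le_km; rewrite ps_truncE //.
by rewrite -{2}(submK le_km) mdegD leq_addr.
Qed.

Lemma mcoeff_expr_lt p e m : p@_0%MM = 0 -> (mdeg m < e)%N -> (p ^+ e)@_m = 0.
Proof.
move=> p0; elim: e m => // e IHe m; rewrite ltnS => le_me.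
rewrite exprS mcoeffM big1 // => -[[k1 h1] [k2 h2]] /= /eqP em.
case: (eqVneq k1 0%MM) => [->|k1n0]; first by rewrite p0 mul0r.
rewrite IHe ?mulr0 // (leq_trans _ le_me) // em mdegD -[X in (X < _)%N]add0n ltn_add2r.
by rewrite lt0n mdeg_eq0.
Qed.

(** Geometric series: up to the constant term, [p] is [1 - u] with [u] free of constant term. The
    coefficient of the inverse at [m] is therefore read off the partial sum of the first
    [(mdeg m).+1] powers of [u]. *)
Lemma ps_of_mpoly_inv p : p@_0%MM != 0 -> exists g, g * ps_of_mpoly p = 1.
Proof.
move=> p0; pose u := 1 - (p@_0%MM)^-1 *: p.
have u0 : u@_0%MM = 0 by rewrite mcoeffB mcoeff1 eqxx mcoeffZ mulVf ?subrr.
have ep : p = p@_0%MM *: (1 - u) by rewrite opprB addrC subrK scalerA divff ?scale1r.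
pose S d := \sum_(i < d) u ^+ i.
exists ((p@_0%MM)^-1 *: MPowser (fun m => (S (mdeg m).+1)@_m)).
rewrite {2}ep ps_of_mpolyZ ps_scaleE [in X in _ * X]ps_scaleE mulrACA.
rewrite -ps_of_mpolyM -mpolyCM mulVf // mpolyC1 ps_of_mpoly1 mul1r.
apply: mpowserP => m.
rewrite (@ps_mulE _ _ _ _ _ (S (mdeg m).+1) (1 - u)) //=; last first.
  move=> k lek /=; rewrite /S -(subnKC (leq_ltn_trans lek (ltnSn _))).
  rewrite big_split_ord /= mcoeffD [X in _ + X](_ : _ = 0) ?addr0 //.
  rewrite raddf_sum big1 // => i _.
  by rewrite /= mcoeff_expr_lt // addSn ltnS leq_addr.
have -> : S (mdeg m).+1 * (1 - u) = 1 - u ^+ (mdeg m).+1.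
  rewrite mulrC -[in RHS](expr1n _ (mdeg m).+1) subrXX; congr (_ * _).
  by apply: eq_bigr => i _; rewrite expr1n mul1r.
by rewrite mcoeffB mcoeff_expr_lt // subr0 mcoeff1.
Qed.

End PowerSeries.

Section Ideal.
Context {T : comNzRingType} (f g : T).
Local Notation I := (ideal2 f g).

Lemma ideal2_0 : I 0.
Proof. by exists 0, 0; rewrite !mul0r addr0. Qed.

Lemma ideal2D x y : I x -> I y -> I (x + y).
Proof.
move=> [a [b ->]] [c [d ->]]; exists (a + c), (b + d).
by rewrite !mulrDl addrACA.
Qed.

Lemma ideal2M x y : I y -> I (x * y).
Proof. by move=> [a [b ->]]; exists (x * a), (x * b); rewrite mulrDr !mulrA. Qed.

Lemma ideal2N x : I x -> I (- x).
Proof. by rewrite -mulN1r; apply: ideal2M. Qed.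

Lemma ideal2B x y : I x -> I y -> I (x - y).
Proof. by move=> Ix Iy; apply: ideal2D => //; apply: ideal2N. Qed.

Lemma ideal2_congrM x y x' y' : I (x - x') -> I (y - y') -> I (x * y - x' * y').
Proof.
move=> Ix Iy; have -> : x * y - x' * y' = y * (x - x') + x' * (y - y').
  by rewrite !mulrBr [y * x]mulrC [y * x']mulrC addrA subrK.
by apply: ideal2D; apply: ideal2M.
Qed.

Lemma ideal2_congr_prod (J : Type) (s : seq J) (F G : J -> T) :
  (forall i, I (F i - G i)) -> I (\prod_(i <- s) F i - \prod_(i <- s) G i).
Proof.
move=> FG; elim: s => [|i s IHs]; first by rewrite !big_nil subrr; apply: ideal2_0.
by rewrite !big_cons; apply: ideal2_congrM.
Qed.

End Ideal.

(** * Restriction to lines *)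

Definition vec2 (K : Type) (x y : K) : 'I_2 -> K := fun i => if i == ord0 then x else y.

Section LineRestriction.
Context {n : nat} {K : fieldType} (d : 'I_n -> K).
Implicit Types (p q : {mpoly K[n]}) (f g : mpowser n K).

(** Pullback to the parametrized line [t |-> (d_i t)]: the coefficient of [t ^ j] is the degree-[j]
    part evaluated at [d]. *)
Definition line_restr : {mpoly K[n]} -> {poly K} := mmap polyC (fun i => d i *: 'X).

HB.instance Definition _ := GRing.RMorphism.copy line_restr
  (mmap polyC (fun i => d i *: 'X)).

Lemma line_restrX i : line_restr 'X_i = d i *: 'X.
Proof. by rewrite /line_restr mmapX mmap1U. Qed.

Lemma line_restrZ a p : line_restr (a *: p) = a *: line_restr p.
Proof. by rewrite /line_restr mmapZ mul_polyC. Qed.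

Lemma coef_line_restr p j : (line_restr p)`_j =
  \sum_(m <- msupp p | mdeg m == j) p@_m * \prod_i d i ^+ m i.
Proof.
rewrite /line_restr /mmap coef_sum [RHS]big_mkcond /=; apply: eq_bigr => m _.
have -> : mmap1 (fun i => d i *: 'X) m = (\prod_i d i ^+ m i) *: 'X^(mdeg m).
  rewrite /mmap1 mdegE -prodrXr -scaler_prod.
  by apply: eq_bigr => i _; rewrite exprZn.
by rewrite coefCM coefZ coefXn eq_sym; case: eqP => _; rewrite ?mulr1 ?mulr0.
Qed.

Lemma eq_line_restr p q j : (forall m, (mdeg m <= j)%N -> p@_m = q@_m) ->
  (line_restr p)`_j = (line_restr q)`_j.
Proof.
move=> epq; apply/eqP; rewrite -subr_eq0 -coefB -rmorphB coef_line_restr /=.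
rewrite big1 // => m /eqP em; rewrite mcoeffB epq ?em ?subrr ?mul0r //.
Qed.

(** Only the terms of degree [j] contribute to [t ^ j], so truncation at [j] extends the pullback to
    power series without any question of convergence. *)
Definition ps_restr f j := (line_restr (ps_trunc j f))`_j.

Lemma ps_restrE f j e : (j <= e)%N -> ps_restr f j = (line_restr (ps_trunc e f))`_j.
Proof.
move=> le_je; apply: eq_line_restr => m lem.
by rewrite !ps_truncE // (leq_trans lem).
Qed.

Lemma ps_restr_of_mpoly p j : ps_restr (ps_of_mpoly p) j = (line_restr p)`_j.
Proof. by apply: eq_line_restr => m lem; rewrite ps_truncE. Qed.

Lemma ps_restrD f g j : ps_restr (f + g) j = ps_restr f j + ps_restr g j.
Proof.
rewrite /ps_restr -coefD -rmorphD; apply: eq_line_restr => m lem.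
by rewrite mcoeffD !ps_truncE.
Qed.

Lemma ps_restrM f g j :
  ps_restr (f * g) j = \sum_(i < j.+1) ps_restr f i * ps_restr g (j - i).
Proof.
have -> : ps_restr (f * g) j = (line_restr (ps_trunc j f * ps_trunc j g))`_j.
  by apply: eq_line_restr => m lem; rewrite ps_truncM // ps_truncE.
rewrite rmorphM coefM; apply: eq_bigr => i _.
by rewrite -!ps_restrE ?leq_subr // -ltnS.
Qed.

(** Restriction is additive and multiplicative, so order at least [N] along a line passes from the
    generators to the ideal. The lower bound on the intersection multiplicity comes from here. *)
Lemma ps_restr_ideal2 p q N : (forall j, (j < N)%N -> (line_restr p)`_j = 0) ->
    (forall j, (j < N)%N -> (line_restr q)`_j = 0) ->
  forall f, ideal2 (ps_of_mpoly p) (ps_of_mpoly q) f ->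
  forall j, (j < N)%N -> ps_restr f j = 0.
Proof.
move=> p0 q0 f [u [v ->]] j ltjN; rewrite ps_restrD !ps_restrM.
by rewrite !big1 ?addr0 // => i _; rewrite ps_restr_of_mpoly ?p0 ?q0 ?mulr0 //;
  apply: leq_ltn_trans ltjN; apply: leq_subr.
Qed.

End LineRestriction.

(** * Order of logarithmic fields along the direction [(- b, 1)] *)

Section Plane.
Context {K : fieldType} (b : K).
Local Notation dir := (vec2 (- b) 1).

(** The value of [x ^ i y ^ j] at [(1 - b t, t)]. These points form the line [x + b y = 1] and
    represent every direction except [(- b, 1)], which is the limit as [t] goes to infinity; this is
    why the top coefficient is the value at [(- b, 1)]. *)
Let Y (i j : nat) : {poly K} := (1 - b *: 'X) ^+ i * 'X^j.

Lemma coef_slope_monomial i j :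
  (size (Y i j) <= (i + j).+1)%N /\ (Y i j)`_(i + j) = (- b) ^+ i.
Proof.
suff H k : let p := (1 - b *: 'X) ^+ k in (size p <= k.+1)%N /\ p`_k = (- b) ^+ k.
  have [sz lc] := H i; split; last by rewrite /Y coefMXn ltnNge leq_addl /= addnK.
  apply: leq_trans (size_polyMleq _ _) _; rewrite size_polyXn addnS /= -addSn.
  by rewrite leq_add2r.
elim: k => [|k [sz lc]] /=; first by rewrite !expr0 size_poly1 coef1.
rewrite exprSr mulrBr mulr1 -scalerAr; split.
  apply: leq_trans (size_polyD _ _) _; rewrite geq_max (leq_trans sz) //= size_polyN.
  apply: leq_trans (size_scale_leq _ _) _; apply: leq_trans (size_polyMleq _ _) _.
  by rewrite size_polyX addn2.
rewrite coefB coefZ coefMX /= lc exprSr nth_default // add0r.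
by rewrite mulrN mulrC.
Qed.

(* The degree-[d] part of [N], restricted to [(1 - b t, t)], is a polynomial in [t]
   of degree at most [d] whose coefficient of [t ^ d] is its value at [(- b, 1)]. *)
Lemma line_restr_many_lines (N : {mpoly K[2]}) (s : seq K) : uniq s ->
    (forall t, t \in s -> line_restr (vec2 (1 - b * t) t) N = 0) ->
  forall d, (d < size s)%N -> (line_restr dir N)`_d = 0.
Proof.
move=> us Ns d ltds.
pose p := \sum_(m <- msupp N | mdeg m == d) N@_m *: Y (m ord0) (m ord_max).
have deg2 (m : 'X_{1..2}) : mdeg m = (m ord0 + m ord_max)%N.
  by rewrite mdegE big_ord_recl big_ord1; congr (_ + m _)%N; apply: val_inj.
have prod2 (c : 'I_2 -> K) (m : 'X_{1..2}) :
    \prod_i c i ^+ m i = c ord0 ^+ m ord0 * c ord_max ^+ m ord_max.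
  by rewrite big_ord_recl big_ord1; congr (_ * c _ ^+ m _); apply: val_inj.
have sz : (size p <= d.+1)%N.
  apply: (big_ind (fun q : {poly K} => size q <= d.+1)%N) => [|x y sx sy|m /eqP em].
  - by rewrite size_poly0.
  - by apply: leq_trans (size_polyD _ _) _; rewrite geq_max sx.
  - apply: leq_trans (size_scale_leq _ _) _; rewrite -em deg2.
    by case: (coef_slope_monomial (m ord0) (m ord_max)).
have p0 : p = 0.
  apply/eqP; apply: contraTT ltds => pn0; rewrite -leqNgt.
  rewrite -ltnS; apply: leq_trans sz; apply: max_poly_roots => //.
  apply/allP => t /Ns /(congr1 (fun q : {poly K} => q`_d)).
  rewrite coef0 coef_line_restr => e; apply/eqP; rewrite -[RHS]e.
  rewrite horner_sum; apply: eq_bigr => m _.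
  by rewrite hornerZ /Y hornerM !horner_exp !hornerE prod2 mulrA.
move/(congr1 (fun q : {poly K} => q`_d)): p0; rewrite coef0 coef_sum => e.
rewrite coef_line_restr -[RHS]e; apply: eq_bigr => m /eqP em.
have [_ lc] := coef_slope_monomial (m ord0) (m ord_max).
by rewrite coefZ -em deg2 lc prod2 /= expr1n mulr1.
Qed.

(** The polynomial [y P - x Q] vanishes on the [size L] distinct lines [r x + s y = 0], hence to
    order at least [size L] along [(- b, 1)]. There it restricts to [t] times [P + b Q], and the
    factor [t] costs one order. *)
Lemma log_field_line_restr (T : eqType) (L : seq T) (r s : T -> K)
    (P Q : {mpoly K[2]}) : uniq L ->
    {in L, forall h, s h - b * r h != 0} ->
    {in L &, forall h h', h != h' -> r h * s h' != r h' * s h} ->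
    {in L, forall h, exists g,
      r h *: P + s h *: Q = g * (r h *: 'X_ord0 + s h *: 'X_ord_max)} ->
  forall j, (j < (size L).-1)%N -> (line_restr dir (P + b *: Q))`_j = 0.
Proof.
move=> uL nz npar hlog j ltj.
(* The parameter [t] for which [(1 - b t, t)] is proportional to [(s h, - r h)], a direction vector
   of the line of [h]. *)
pose sl h := - r h / (s h - b * r h).
pose N := 'X_ord_max * P - 'X_ord0 * Q.
have eN : line_restr dir N = 'X * line_restr dir (P + b *: Q).
  rewrite rmorphB !rmorphM rmorphD /= !line_restrX line_restrZ /= scale1r mulrDr.
  by rewrite scaleNr mulNr opprK -scalerAr -scalerAl.
have -> : (line_restr dir (P + b *: Q))`_j = (line_restr dir N)`_j.+1.
  by rewrite eN coefXM.
apply: (@line_restr_many_lines N (map sl L)).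
- rewrite map_inj_in_uniq // => h h' hL h'L /eqP.
  rewrite eqr_div ?nz // => /eqP e; apply: contraTeq isT => /(npar _ _ hL h'L)/eqP; case.
  apply/eqP; rewrite -subr_eq0; apply/eqP; move/eqP: e; rewrite -subr_eq0 => /eqP e.
  by rewrite -[RHS]oppr0 -[in RHS]e; ring.
- move=> _ /mapP [h hL ->]; have [g eg] := hlog h hL.
  set t := sl h; set v := vec2 _ _.
  have := congr1 (line_restr v) eg.
  rewrite rmorphM !rmorphD /= !line_restrZ !line_restrX !scalerA -scalerDl /=.
  have nzh := nz h hL.
  have -> : r h * (1 - b * t) + s h * t = 0 by rewrite /t /sl; field.
  rewrite scale0r mulr0 => e.
  rewrite rmorphN !rmorphM /= !line_restrX /=.
  (* On this line [y P - x Q] is a multiple of [r P + s Q], which vanishes there by tangency. *)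
  have -> : t *: 'X * line_restr v P - (1 - b * t) *: 'X * line_restr v Q =
     - ((s h - b * r h)^-1 *: 'X) * (r h *: line_restr v P + s h *: line_restr v Q).
    rewrite (_ : 1 - b * t = s h / (s h - b * r h)); last by rewrite /t /sl; field.
    rewrite /t /sl -!mul_polyC !polyCM polyCN. ring.
  by rewrite e mulr0.
- by rewrite size_map; case: (size L) ltj.
Qed.

End Plane.

(** * Quotients having the first [n] powers of [y] as a basis *)

Section QuotientDimension.
Context {K : fieldType} (b : K) (F G : {mpoly K[2]}) (n : nat).
Local Notation I := (ideal2 (ps_of_mpoly F) (ps_of_mpoly G)).
Local Notation x := ('X_ord0 : {mpoly K[2]}).
Local Notation y := ('X_ord_max : {mpoly K[2]}).
Local Notation ps := ps_of_mpoly.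

Hypothesis I_line : I (ps (x + b *: y)).
Hypothesis I_power : I (ps (y ^+ n)).
Hypothesis restrF : forall j, (j < n)%N -> (line_restr (vec2 (- b) 1) F)`_j = 0.
Hypothesis restrG : forall j, (j < n)%N -> (line_restr (vec2 (- b) 1) G)`_j = 0.

Let spanned (v : mpowser 2 K) :=
  exists c : 'rV[K]_n, I (v - \sum_i c 0 i *: ps (y ^+ i)).

Let spannedI v : I v -> spanned v.
Proof.
move=> Iv; exists 0; rewrite big1 ?subr0 // => i _.
by rewrite mxE scale0r.
Qed.

Let spannedD u v : spanned u -> spanned v -> spanned (u + v).
Proof.
move=> [c Ic] [d Id]; exists (c + d).
under eq_bigr do rewrite mxE scalerDl.
by rewrite big_split /= opprD addrACA; apply: ideal2D.
Qed.

Let spannedZ a v : spanned v -> spanned (a *: v).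
Proof.
move=> [c Ic]; exists (a *: c).
under eq_bigr do rewrite mxE -scalerA.
by rewrite -scaler_sumr -scalerBr ps_scaleE; apply: ideal2M.
Qed.

Let I_powerS k : (n <= k)%N -> I (ps (y ^+ k)).
Proof.
by move=> le_nk; rewrite -(subnK le_nk) exprD ps_of_mpolyM; apply: ideal2M.
Qed.

Let spanned_power k : spanned (ps (y ^+ k)).
Proof.
case: (leqP n k) => [le_nk|lt_kn]; first exact/spannedI/I_powerS.
exists (delta_mx 0 (Ordinal lt_kn)).
rewrite (bigD1 (Ordinal lt_kn)) //= mxE !eqxx scale1r big1 ?addr0 ?subrr.
  exact: ideal2_0.
by move=> i /negbTE ne; rewrite mxE ne andbF scale0r.
Qed.

Let I_xpower k : I (ps (x ^+ k) - (- b) ^+ k *: ps (y ^+ k)).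
Proof.
rewrite -ps_of_mpolyZ -exprZn -ps_of_mpolyN -ps_of_mpolyD.
have -> : x ^+ k - (- b *: y) ^+ k =
    (\sum_(i < k) x ^+ (k.-1 - i) * (- b *: y) ^+ i) * (x + b *: y).
  by rewrite subrXX mulrC scaleNr opprK.
by rewrite ps_of_mpolyM; apply: ideal2M.
Qed.

Let monomialE (m : 'X_{1..2}) : 'X_[m] = x ^+ m ord0 * y ^+ m ord_max.
Proof.
by rewrite mpolyXE_id big_ord_recl big_ord1; congr (_ * 'X_ _ ^+ m _); apply: val_inj.
Qed.

Let spanned_mpoly p : spanned (ps p).
Proof.
elim/mpolyind: p => [|c m p _ _ IHp].
  by rewrite ps_of_mpoly0; apply/spannedI/ideal2_0.
rewrite ps_of_mpolyD; apply: spannedD IHp; rewrite ps_of_mpolyZ; apply: spannedZ.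
rewrite monomialE ps_of_mpolyM -[ps (x ^+ _)](subrK ((- b) ^+ m ord0 *: ps (y ^+ m ord0))).
rewrite mulrDl; apply: spannedD.
  by apply: spannedI; rewrite mulrC; apply: ideal2M; apply: I_xpower.
rewrite -ps_of_mpolyZ -ps_of_mpolyM -scalerAl -exprD ps_of_mpolyZ.
by apply: spannedZ; apply: spanned_power.
Qed.

Let mnm_le1 (i : 'I_2) k (m : 'X_{1..2}) : (U_(i) *+ k <= m)%MM = (k <= m i)%N.
Proof.
apply/mnm_lepP/idP => [/(_ i)|le_km j]; rewrite mulmnE mnm1E ?eqxx ?mul1n //.
by case: eqP => [<-|_]; rewrite ?mul1n ?mul0n.
Qed.

(** A monomial of degree above [n + n] is divisible by [x ^ n] or by [y ^ n]. The tail of [v] is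
    thus exactly [x ^ n wx + y ^ n wy], an element of the ideal, and only a polynomial remains. *)
Let spanned_all v : spanned v.
Proof.
pose T := ps_trunc (n + n) v; have [w wE] : {w | w = v - ps T} by exists (v - ps T).
have w0 m : (mdeg m <= n + n)%N -> pscoeff w m = 0.
  by move=> lem; rewrite wE /= ps_truncE // subrr.
pose wx := MPowser (fun m => pscoeff w (m + U_(ord0) *+ n)%MM).
(* The test on [m ord0] keeps monomials divisible by both powers from being counted twice. *)
pose wy := MPowser (fun m => if (m ord0 < n)%N
                             then pscoeff w (m + U_(ord_max) *+ n)%MM else 0).
have ew : w = ps 'X_[U_(ord0) *+ n] * wx + ps 'X_[U_(ord_max) *+ n] * wy.
  apply: mpowserP => m.
  rewrite -[RHS]/(pscoeff (_ * wx) m + pscoeff (_ * wy) m) !pscoeff_mulX !mnm_le1.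
  case: (leqP n (m ord0)) => [le0|lt0].
    rewrite {1}/wx /= submK ?mnm_le1 // [X in _ + X](_ : _ = 0) ?addr0 //.
    case: ifP => // _; rewrite mnmBE mulmnE mnm1E /= mul0n subn0.
    by rewrite ltnNge le0.
  rewrite add0r; case: ifP => [le1|/negbT].
    by rewrite /wy /= mnmBE mulmnE mnm1E /= mul0n subn0 lt0 submK ?mnm_le1.
  rewrite -ltnNge => lt1; rewrite w0 // mdegE big_ord_recl big_ord1.
  apply: leq_add; first exact: ltnW.
  by apply: ltnW; rewrite (_ : lift _ _ = ord_max) //; apply: val_inj.
rewrite -[v](subrK (ps T)) addrC; apply: spannedD; first exact: spanned_mpoly.
apply: spannedI; rewrite -wE ew -!mpolyXn.
apply: ideal2D; rewrite mulrC; apply: ideal2M; last exact: I_power.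
rewrite -[ps (x ^+ n)](subrK ((- b) ^+ n *: ps (y ^+ n))); apply: ideal2D; first exact: I_xpower.
by rewrite ps_scaleE; apply: ideal2M.
Qed.

(** Along [(- b, 1)] an element of the ideal has order at least [n], while the combination restricts
    to the polynomial with coefficients [c 0 i], of degree below [n]. *)
Let coef_unique (c : 'rV[K]_n) : I (\sum_i c 0 i *: ps (y ^+ i)) -> c = 0.
Proof.
move=> Ic; apply/rowP => j; rewrite mxE.
have := ps_restr_ideal2 restrF restrG Ic (ltn_ord j).
have -> : \sum_i c 0 i *: ps (y ^+ i) = ps (\sum_i c 0 i *: y ^+ i).
  rewrite (big_morph ps (@ps_of_mpolyD _ _) (@ps_of_mpoly0 _ _)).
  by apply: eq_bigr => i _; rewrite ps_of_mpolyZ.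
rewrite ps_restr_of_mpoly rmorph_sum coef_sum (bigD1 j) //=.
have eX i : line_restr (vec2 (- b) 1) (c 0 i *: y ^+ i) = c 0 i *: 'X^i.
  by rewrite line_restrZ rmorphXn /= line_restrX scale1r.
rewrite eX coefZ coefXn eqxx mulr1 big1 ?addr0 // => i /negbTE ne.
by rewrite eX coefZ coefXn (inj_eq val_inj) eq_sym ne mulr0.
Qed.

(** Modulo the ideal [x] becomes [- b y] and [y ^ n] becomes 0, which gives generation; restriction
    along [(- b, 1)] gives independence. *)
Lemma quotient_dim_line : quotient_dim I n.
Proof.
exists (fun i => ps (y ^+ i)) => v; have [c Ic] := spanned_all v.
exists c; split=> // d Id; apply/eqP; rewrite -subr_eq0; apply/eqP/coef_unique.
have := ideal2B Id Ic; rewrite opprB addrC addrA subrK => Icd.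
under eq_bigr do rewrite !mxE scalerBl.
by rewrite sumrB.
Qed.

End QuotientDimension.

(** * Homogeneous polynomials and derivations *)

Lemma mpoly_ring_ind (n : nat) (R : nzRingType) (P : {mpoly R[n]} -> Prop) :
    (forall c, P c%:MP) -> (forall i, P 'X_i) ->
    (forall p q, P p -> P q -> P (p + q)) -> (forall p q, P p -> P q -> P (p * q)) ->
  forall p, P p.
Proof.
move=> PC PX PD PM; elim/mpolyind => [|c m p _ _ Pp]; first exact: (PC 0).
apply: PD Pp; rewrite -mul_mpolyC; apply: (PM) => //.
rewrite mpolyXE_id; elim/big_ind: _ => [||i _]; [exact: (PC 1) | exact: PM |].
by elim: (m i) => [|k IHk]; [apply: (PC 1) | rewrite exprS; apply: PM].
Qed.

Section Homogeneous.
Context {n : nat} {R : idomainType}.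
Implicit Types p q r : {mpoly R[n]}.

Lemma linear_formE p : p \is 1.-homog -> p = \sum_i p@_U_(i) *: 'X_i.
Proof.
move=> hp; apply/mpolyP => m; rewrite raddf_sum /=.
under eq_bigr do rewrite mcoeffZ mcoeffX.
case: (eqVneq (mdeg m) 1%N) => [/eqP/mdeg1P[i /eqP ->]|ne].
  rewrite (bigD1 i) //= eqxx mulr1 big1 ?addr0 // => j /negbTE ne.
  by rewrite eq_mnm1 ne mulr0.
rewrite (dhomog_nemf_coeff hp ne) big1 // => i _.
by case: eqP => [em|_]; rewrite ?mulr0 //; move: ne; rewrite -em mdeg1.
Qed.

Lemma pihomogM1 p q k : q \is 1.-homog ->
  pihomog mdeg k.+1 (p * q) = pihomog mdeg k p * q.
Proof.
move=> hq; elim/mpolyind: p => [|c m p _ _ IHp]; first by rewrite !linear0 mul0r linear0.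
rewrite mulrDl !linearD /= mulrDl IHp; congr (_ + _).
rewrite -scalerAl !linearZ /= -scalerAl; congr (_ *: _).
have hm : 'X_[m] * q \is (mdeg m).+1.-homog.
  by rewrite -addn1; apply: dhomogM; rewrite ?dhomogX.
rewrite pihomogX; case: eqP => [<-|/eqP ne]; first by rewrite pihomog_dE.
by rewrite mul0r (@pihomog_ne0 _ _ _ (mdeg m).+1).
Qed.

(* For [e = 0] the quotient [p] must vanish, [e.-1] being a junk degree. *)
Lemma dhomog_divl p q e : p * q \is e.-homog -> q \is 1.-homog -> q != 0 ->
  p \is e.-1.-homog /\ (e = 0%N -> p = 0).
Proof.
move=> hpq hq qn0.
have z k : k.+1 != e -> pihomog mdeg k p = 0.
  rewrite eq_sym => ne; apply/eqP; move/eqP: (pihomogM1 p k hq).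
  by rewrite (pihomog_ne0 ne) // eq_sym mulf_eq0 (negbTE qn0) orbF.
have ep := pihomog_partitionE (leqnn (msize p)) : p = _.
case: e hpq z => [|e] hpq z; split => //.
- by rewrite ep big1 ?dhomog0 // => k _; apply: z.
- by move=> _; rewrite ep big1 // => k _; apply: z.
- rewrite ep; apply: rpred_sum => k _; case: (eqVneq k.+1 e.+1) => [[->]|/z ->].
    exact: pihomogP.
  exact: dhomog0.
Qed.

Lemma dhomog0_const p : p \is 0.-homog -> p = (p@_0%MM)%:MP.
Proof.
move=> hp; apply/mpolyP => m; rewrite mcoeffC; case: (eqVneq m 0%MM) => [->|ne].
  by rewrite mulr1.
by rewrite mulr0 (dhomog_nemf_coeff hp) // mdeg_eq0.
Qed.

End Homogeneous.

Section Derivations.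
Context {K : fieldType} {n : nat}.
Local Notation S := {mpoly K[n]}.
Implicit Types (d : S -> S) (p q : S).

Lemma derivation_eq0 d : derivation d -> (forall i, d 'X_i = 0) -> forall f, d f = 0.
Proof.
move=> [lin_d leib_d] dX.
have dD p q : d (p + q) = d p + d q by have := lin_d 1 p q; rewrite !scale1r.
have dZ a p : d (a *: p) = a *: d p.
  have := lin_d a p 0; have := lin_d (-1) 0 0.
  by rewrite scaler0 scaleN1r !addr0 addNr => ->; rewrite addr0.
have d1 : d 1 = 0.
  by have := leib_d 1 1; rewrite !mulr1 mul1r => e; apply: (addIr (d 1)); rewrite add0r -e.
elim/mpoly_ring_ind => [c|//|p q dp dq|p q dp dq].
- by rewrite -alg_mpolyC dZ d1 scaler0.
- by rewrite dD dp dq addr0.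
- by rewrite leib_d dp dq mul0r mulr0 addr0.
Qed.

Definition deriv_along (v : 'I_n -> S) (f : S) := \sum_i v i * f^`M(i).

Lemma deriv_along_derivation v : derivation (deriv_along v).
Proof.
split=> [a f g|f g]; rewrite /deriv_along.
  rewrite scaler_sumr -big_split /=; apply: eq_bigr => i _.
  by rewrite linearP /= mulrDr scalerAr.
rewrite mulr_suml mulr_sumr -big_split /=; apply: eq_bigr => i _.
by rewrite mderivM mulrDr !mulrA [f * _]mulrC.
Qed.

Lemma deriv_along_linear v p : p \is 1.-homog ->
  deriv_along v p = \sum_i p@_U_(i) *: v i.
Proof.
move=> hp; rewrite /deriv_along; apply: eq_bigr => i _.
rewrite {1}(linear_formE hp) linear_sum (bigD1 i) //= linearZ /= mderivX.
rewrite mnm1E eqxx scale1r (_ : (U_(i) - U_(i))%MM = 0%MM); last first.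
  by apply/mnmP => j; rewrite mnmBE subnn mnm0E.
rewrite mpolyX0 big1 ?addr0 -?scalerAr ?mulr1 // => j /negbTE ne.
by rewrite linearZ /= mderivX mnm1E ne scale0r scaler0.
Qed.

Lemma derivation_comb r (delta : 'I_r -> S -> S) (c : 'I_r -> S) :
  (forall j, derivation (delta j)) -> derivation (fun f => \sum_j c j * delta j f).
Proof.
move=> dd; split=> [a f g|f g].
  rewrite scaler_sumr -big_split /=; apply: eq_bigr => i _.
  by rewrite (dd i).1 mulrDr scalerAr.
rewrite mulr_suml mulr_sumr -big_split /=; apply: eq_bigr => i _.
by rewrite (dd i).2 mulrDr !mulrA [f * _]mulrC.
Qed.

Lemma derivation_sum d (I : Type) (s : seq I) (a : I -> K) (p : I -> S) :
  derivation d -> d (\sum_(i <- s) a i *: p i) = \sum_(i <- s) a i *: d (p i).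
Proof.
move=> [lin_d _]; elim: s => [|i s IHs]; last by rewrite !big_cons lin_d IHs.
by rewrite !big_nil; have := lin_d (-1) 0 0; rewrite scaler0 addr0 scaleN1r addNr.
Qed.

End Derivations.

(** * Logarithmic derivations vanishing at [z_0] *)

Local Notation o0 := (ord0 : 'I_3).
Local Notation o1 := (lift ord0 ord0 : 'I_3).
Local Notation o2 := (lift ord0 (lift ord0 ord0) : 'I_3).

Lemma big_ord3 (V : nmodType) (F : 'I_3 -> V) : \sum_i F i = F o0 + (F o1 + F o2).
Proof. by rewrite !big_ord_recl big_ord0 addr0. Qed.

Section Coordinates.
Context {K : fieldType} (Z : 'M[K]_3).
Hypothesis Zu : Z \in unitmx.
Local Notation S := {mpoly K[3]}.

Definition coord_form (j : 'I_3) : S := \sum_i Z i j *: 'X_i.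

(* The coefficients of a linear form in the coordinates [z_0, z_1, z_2]. *)
Definition form_coef (p : S) (j : 'I_3) : K := \sum_i invmx Z j i * p@_U_(i).

Lemma coord_form_homog j : coord_form j \is 1.-homog.
Proof. by apply: rpred_sum => i _; rewrite dhomogZ // dhomogX /= mdeg1. Qed.

Lemma mpolyX_coord i : 'X_i = \sum_j invmx Z j i *: coord_form j :> S.
Proof.
under eq_bigr do rewrite scaler_sumr; rewrite exchange_big /=.
transitivity (\sum_k (Z *m invmx Z) k i *: ('X_k : S)).
  rewrite mulmxV // (bigD1 i) //= mxE eqxx scale1r big1 ?addr0 // => k /negbTE ne.
  by rewrite mxE ne scale0r.
apply: eq_bigr => k _; rewrite mxE scaler_suml; apply: eq_bigr => j _.
by rewrite scalerA mulrC.
Qed.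

Lemma form_coefE p : p \is 1.-homog -> p = \sum_j form_coef p j *: coord_form j.
Proof.
move=> /linear_formE {1}->; under eq_bigr do rewrite mpolyX_coord scaler_sumr.
rewrite exchange_big; apply: eq_bigr => j _; rewrite scaler_suml.
by apply: eq_bigr => i _; rewrite scalerA mulrC.
Qed.

Lemma mcoeff_coord_form i j : (coord_form j)@_U_(i) = Z i j.
Proof.
rewrite raddf_sum (bigD1 i) //= mcoeffZ mcoeffXU eqxx mulr1 big1 ?addr0 // => k /negbTE ne.
by rewrite mcoeffZ mcoeffXU ne mulr0.
Qed.

Lemma form_coef_coord j k : form_coef (coord_form k) j = (j == k)%:R.
Proof.
transitivity ((invmx Z *m Z) j k); last by rewrite mulVmx // mxE.
by rewrite mxE; apply: eq_bigr => i _; rewrite mcoeff_coord_form.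
Qed.

Lemma coord_form_neq0 j : coord_form j != 0.
Proof.
apply/eqP => e; have := form_coef_coord j j; rewrite e eqxx /form_coef.
rewrite big1 => [/esym/eqP|i _]; first by rewrite oner_eq0.
by rewrite mcoeff0 mulr0.
Qed.

Lemma derivation_form (d : S -> S) p : derivation d -> p \is 1.-homog ->
  d p = \sum_j form_coef p j *: d (coord_form j).
Proof. by move=> dd /form_coefE {1}->; rewrite derivation_sum. Qed.

(** The field with value 0 on [z_0], [g] on [z_1] and [h] on [z_2], written through its values on
    the original variables. *)
Definition pair_field (g h : S) : S -> S :=
  deriv_along (fun i => invmx Z o1 i *: g + invmx Z o2 i *: h).

Lemma pair_field_form g h p : p \is 1.-homog ->
  pair_field g h p = form_coef p o1 *: g + form_coef p o2 *: h.
Proof.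
move=> hp; rewrite /pair_field deriv_along_linear // /form_coef !scaler_suml.
rewrite -big_split; apply: eq_bigr => i _ /=.
by rewrite scalerDr !scalerA ![_ * p@__]mulrC.
Qed.

Lemma pair_field_coord g h : [/\ pair_field g h (coord_form o0) = 0,
  pair_field g h (coord_form o1) = g & pair_field g h (coord_form o2) = h].
Proof.
rewrite !pair_field_form ?coord_form_homog // !form_coef_coord /=.
by rewrite !scale0r !scale1r !addr0 add0r.
Qed.

Lemma derivation_coord_eq0 (d : S -> S) : derivation d ->
  (forall j, d (coord_form j) = 0) -> forall f, d f = 0.
Proof.
move=> dd dz; apply: derivation_eq0 => // i.
by rewrite mpolyX_coord derivation_sum // big1 // => j _; rewrite dz scaler0.
Qed.

End Coordinates.

Section LogarithmicPairs.
Context {K : fieldType} (Z : 'M[K]_3) (A : {fset {vspace 'rV[K]_3}}).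
Context (alpha : {vspace 'rV[K]_3} -> {mpoly K[3]}).
Local Notation S := {mpoly K[3]}.

(** By [pair_field_form] the left-hand side is [pair_field Z g h (alpha H)]. Spelling it out reduces
    the rest of the argument to polynomial identities. *)
Definition log_pair (g h : S) := forall H, H \in A -> exists q,
  form_coef Z (alpha H) o1 *: g + form_coef Z (alpha H) o2 *: h = q * alpha H.

(* [(g1, h1)] and [(g2, h2)] are the values at [(z_1, z_2)] of a basis of the
   logarithmic derivations that vanish at [z_0]. *)
Record log_pair_basis (e1 e2 : nat) (g1 h1 g2 h2 : S) : Prop := LogPairBasis {
  log_basis_homog1 : g1 \is e1.-homog /\ h1 \is e1.-homog;
  log_basis_homog2 : g2 \is e2.-homog /\ h2 \is e2.-homog;
  log_basis_log1 : log_pair g1 h1;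
  log_basis_log2 : log_pair g2 h2;
  log_basis_span : forall g h, log_pair g h ->
    exists c1 c2, g = c1 * g1 + c2 * g2 /\ h = c1 * h1 + c2 * h2;
  log_basis_free : forall c1 c2, c1 * g1 + c2 * g2 = 0 -> c1 * h1 + c2 * h2 = 0 ->
    c1 = 0 /\ c2 = 0 }.

Hypothesis Zu : Z \in unitmx.
Hypothesis alpha_homog : forall H, H \in A -> alpha H \is 1.-homog.
Context (H0 : {vspace 'rV[K]_3}) (u0 : K).
Hypothesis H0A : H0 \in A.
Hypothesis u0n0 : u0 != 0.
Hypothesis alphaH0 : alpha H0 = u0 *: coord_form Z o0.
Local Notation z := (coord_form Z).

Lemma log_pair_fieldP g h : log_pair g h <-> log_derivation A alpha (pair_field Z g h).
Proof.
split=> [lgh|[_ lgh] H HA].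
  split; first exact: deriv_along_derivation.
  by move=> H HA; rewrite pair_field_form ?alpha_homog //; apply: lgh.
by have := lgh H HA; rewrite pair_field_form ?alpha_homog.
Qed.

Lemma log_derivation_z0 d : log_derivation A alpha d -> exists q, d (z o0) = q * z o0.
Proof.
move=> [dd ld]; have [q eq] := ld H0 H0A; exists q.
have d_z : u0 *: d (z o0) = d (alpha H0).
  have := derivation_sum [:: tt] (fun=> u0) (fun=> z o0) dd.
  by rewrite !big_seq1 alphaH0.
by apply: (scalerI u0n0); rewrite d_z eq alphaH0 scalerAr.
Qed.

Section Reduction.
Context (e : 'I_3 -> nat) (delta : 'I_3 -> S -> S) (h : 'I_3 -> S) (i : 'I_3) (u : K).
Hypothesis delta_basis : is_basis (log_derivation A alpha) delta.
Hypothesis delta_homog : forall j, derivation_homog (e j) (delta j).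
Hypothesis delta_z0 : forall j, delta j (z o0) = h j * z o0.
Hypothesis un0 : u != 0.
Hypothesis hi : h i = u%:MP.
Hypothesis ei : e i = 1%N.

Let dd j : derivation (delta j). Proof. by have [[]] := delta_basis.1 j. Qed.

(** The value at [z_k] of [delta j - u^-1 h_j delta i], the correction of [delta j] that kills
    [z_0]. *)
Let G j k := delta j (z k) - u^-1 *: (h j * delta i (z k)).

Let delta_z_homog j k : delta j (z k) \is (e j).-homog.
Proof.
rewrite derivation_sum //; apply: rpred_sum => m _.
by rewrite dhomogZ //; apply: delta_homog.
Qed.

Let G_homog j k : G j k \is (e j).-homog.
Proof.
have hz : h j * z o0 \is (e j).-homog by rewrite -delta_z0.
have [hh h0] := dhomog_divl hz (coord_form_homog _ _) (coord_form_neq0 Zu _).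
rewrite /G; apply: rpredB; first exact: delta_z_homog.
rewrite dhomogZ //.
(* In degree 0 the multiplier [h j] vanishes; otherwise its degree [(e j).-1] and the degree 1 of
   [delta i] add up to [e j]. *)
case: (eqVneq (e j) 0%N) => [/h0->|ne]; first by rewrite mul0r dhomog0.
have -> : e j = ((e j).-1 + 1)%N by rewrite addn1 prednK // lt0n.
by apply: dhomogM => //; have := delta_z_homog i k; rewrite ei.
Qed.

Let G_z0 j : G j o0 = 0.
Proof.
rewrite /G !delta_z0 hi mulrCA mul_mpolyC scalerA.
by rewrite mulVf // scale1r subrr.
Qed.

Let G_i k : G i k = 0.
Proof. by rewrite /G hi mul_mpolyC scalerA mulVf // scale1r subrr. Qed.

Let G_log j : log_pair (G j o1) (G j o2).
Proof.
move=> H HA; have [_ /(_ H HA) [qj ej]] := delta_basis.1 j.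
have [_ /(_ H HA) [qi eqi]] := delta_basis.1 i.
exists (qj - u^-1 *: (h j * qi)).
transitivity (\sum_k form_coef Z (alpha H) k *: G j k).
  by rewrite big_ord3 G_z0 scaler0 add0r.
under eq_bigr do rewrite scalerBr.
rewrite sumrB -derivation_form ?alpha_homog // ej mulrBl; congr (_ - _).
rewrite -scalerAl -mulrA -eqi [delta i _](derivation_form Zu) ?alpha_homog //.
rewrite mulr_sumr scaler_sumr; apply: eq_bigr => k _.
by rewrite -scalerAr !scalerA mulrC.
Qed.

(** A combination of the [delta j] that kills [z_0] has coefficients with [\sum_j c_j h_j = 0], so
    each [delta j] may be replaced by its correction, and that of [delta i] is zero. Conversely, a
    relation between the two other corrections expands to one between the [delta j]. *)
Lemma log_pair_basis_of_index (j1 j2 : 'I_3) : i != j1 -> i != j2 -> j1 != j2 ->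
  (forall F : 'I_3 -> S, \sum_j F j = F i + (F j1 + F j2)) ->
  log_pair_basis (e j1) (e j2) (G j1 o1) (G j1 o2) (G j2 o1) (G j2 o2).
Proof.
move=> n1 n2 n12 sumE; split => //.
- move=> g k /log_pair_fieldP /(delta_basis.2) [c [Ec _]].
  have [f0 f1 f2] := pair_field_coord Zu g k.
  have c0 : \sum_j c 0 j * h j = 0.
    apply: (mulIf (coord_form_neq0 Zu o0)); rewrite mul0r mulr_suml -[RHS]f0 Ec.
    by apply: eq_bigr => j _; rewrite delta_z0 mulrA.
  have cG m : \sum_j c 0 j * delta j (z m) = c 0 j1 * G j1 m + c 0 j2 * G j2 m.
    transitivity (\sum_j c 0 j * G j m); last by rewrite sumE G_i mulr0 add0r.
    under [RHS]eq_bigr do rewrite mulrBr -scalerAr mulrA.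
    by rewrite sumrB -scaler_sumr -mulr_suml c0 mul0r scaler0 subr0.
  exists (c 0 j1), (c 0 j2); split; first by rewrite -[LHS]f1 Ec cG.
  by rewrite -[LHS]f2 Ec cG.
- move=> c1 c2 E1 E2.
  (* The coefficient that [delta i] acquires when the two corrected fields are expanded. *)
  pose ci := - (u^-1 *: (c1 * h j1 + c2 * h j2)).
  pose c : 'rV[S]_3 := \row_j (if j == i then ci else if j == j1 then c1 else c2).
  have [ci_ cj1 cj2] : [/\ c 0 i = ci, c 0 j1 = c1 & c 0 j2 = c2].
    by rewrite !mxE !eqxx ![_ == i]eq_sym (negbTE n1) (negbTE n2) [j2 == _]eq_sym (negbTE n12).
  have c_eq0 f : \sum_j c 0 j * delta j f = 0.
    move: f; apply: (derivation_coord_eq0 Zu); first exact: derivation_comb.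
    move=> k; rewrite sumE ci_ cj1 cj2.
    have : c1 * G j1 k + c2 * G j2 k = 0.
      case: (unliftP o0 k) => [k'|] ->; last by rewrite !G_z0 !mulr0 addr0.
      case: (unliftP ord0 k') => [k''|] -> //.
      by rewrite (_ : lift ord0 (lift ord0 k'') = o2) //; apply: val_inj; case: k'' => [[]].
    rewrite !mulrBr -!scalerAr addrACA -opprD -scalerDr !mulrA -mulrDl => e0.
    rewrite /ci mulNr -scalerAl addrC; exact: e0.
  (* The zero derivation is logarithmic, and uniqueness of its coefficients is linear
     independence. *)
  have [c' [_ uc]] : exists! c : 'rV[S]_3, forall f, 0 = \sum_j c 0 j * delta j f.
    apply: (delta_basis.2 (fun=> 0)); split.
      by split=> [a f f'|f f'] /=; rewrite ?scaler0 ?mulr0 ?mul0r ?addr0.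
    by move=> H _; exists 0; rewrite mul0r.
  have cc : c = 0.
    rewrite -(uc c (fun f => esym (c_eq0 f))); apply: uc => f.
    by rewrite big1 // => j _; rewrite mxE mul0r.
  by rewrite -cj1 -cj2 cc !mxE.
Qed.

End Reduction.

(** The Euler field fixes [z_0], so [\sum_j c_j h_j = 1] and some [h i] has a nonzero constant term.
    Being homogeneous of degree one less than the exponent of [delta i], it is a constant and that
    exponent is 1; [delta i] then serves to correct the two others. *)
Lemma free_log_pair_basis e1 e2 : free_with_exponents A alpha [tuple 1%N; e1; e2] ->
  exists g1 h1 g2 h2, log_pair_basis e1 e2 g1 h1 g2 h2.
Proof.
move=> [delta [delta_basis delta_homog]].
have /choice [h hE] j : exists q, delta j (z o0) = q * z o0.
  exact/log_derivation_z0/delta_basis.1.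
have eulerE p : p \is 1.-homog -> deriv_along (fun i => 'X_i) p = p.
  by move=> hp; rewrite deriv_along_linear // -linear_formE.
have [c [Ec _]] : exists! c : 'rV[S]_3, forall f,
    deriv_along (fun i => 'X_i) f = \sum_i c 0 i * delta i f.
  apply: delta_basis.2; split; first exact: deriv_along_derivation.
  by move=> H HA; exists 1; rewrite eulerE ?alpha_homog ?mul1r.
have c1 : \sum_j c 0 j * h j = 1.
  apply: (mulIf (coord_form_neq0 Zu o0)).
  rewrite mul1r mulr_suml -[RHS]eulerE ?coord_form_homog // Ec.
  by apply: eq_bigr => j _; rewrite hE mulrA.
have [i hi0] : exists i, (h i)@_0%MM != 0.
  apply: contrapT => /forallNP nh; have := congr1 (mcoeff 0%MM) c1.
  rewrite rmorph1 raddf_sum big1 => [/esym/eqP|j _] /=; first by rewrite oner_eq0.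
  by have /negP/negPn/eqP hj0 := nh j; rewrite rmorphM /= hj0 mulr0.
set ee := fun j => tnth [tuple 1%N; e1; e2] j.
have hz : h i * z o0 \is (ee i).-homog.
  rewrite -hE derivation_sum; last by have [[]] := delta_basis.1 i.
  by apply: rpred_sum => m _; rewrite dhomogZ //; apply: delta_homog.
have [hh h0] := dhomog_divl hz (coord_form_homog _ _) (coord_form_neq0 Zu _).
have ei : ee i = 1%N.
  case E : (ee i) => [|[|k]] //; first by move: hi0; rewrite h0 // mcoeff0 eqxx.
  by move: hi0; rewrite (dhomog_nemf_coeff hh) ?eqxx //= mdeg0 E.
have hiC : h i = ((h i)@_0%MM)%:MP by apply: dhomog0_const; rewrite ei in hh.
have B := log_pair_basis_of_index delta_basis delta_homog hE hi0 hiC ei.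
(* If [i] is not the first index, its exponent [e1] or [e2] equals 1, and the first basis field
   takes its place. *)
case: (unliftP o0 i) B ei {hz hh h0 hiC hi0} => [i'|] ->; last first.
  move=> B _; do 4!eexists; apply: (B o1 o2) => // F.
  exact: big_ord3.
case: (unliftP ord0 i') => [i''|] ->.
  rewrite (_ : lift ord0 (lift ord0 i'') = o2); last first.
    by apply: val_inj; case: i'' => [[]].
  move=> B e2E; rewrite -[e2]/(ee o2) e2E -[1%N]/(ee o0).
  do 4!eexists; apply: (B o1 o0) => // F.
  by rewrite big_ord3 addrA addrC [F o0 + _]addrC.
move=> B e1E; rewrite -[e1]/(ee o1) e1E -[1%N]/(ee o0).
do 4!eexists; apply: (B o0 o2) => // F.
by rewrite big_ord3 addrCA.
Qed.

End LogarithmicPairs.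

(** * Dehomogenization *)

Lemma dhomog_msize_neq0 (n : nat) (R : nzRingType) (p q : {mpoly R[n]}) e :
  p \is e.-homog -> p != 0 -> (msize q <= e)%N -> msize (p + q) = e.+1.
Proof.
move=> hp pn0 szq; apply/eqP; rewrite eqn_leq; apply/andP; split.
  apply: leq_trans (msizeD_le _ _) _; rewrite geq_max (leq_trans szq) // andbT.
  rewrite msizeE big_seq; elim/big_ind: _ => // [x y xe ye|m /(dhomog_mf hp) /= <- //].
  by rewrite geq_max xe.
have [m mp em] : exists2 m, m \in msupp p & mdeg m = e.
  by have lp := mlead_supp pn0; exists (mlead p) => //; apply: (dhomog_mf hp lp).
rewrite -em; apply: msize_mdeg_lt; rewrite mcoeff_msupp mcoeffD.
rewrite (memN_msupp_eq0 (_ : m \notin msupp q)) ?addr0 -?mcoeff_msupp //.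
by apply: msize_mdeg_ge; rewrite em.
Qed.

Section Dehomogenization.
Context {K : fieldType} (Z : 'M[K]_3).
Hypothesis Zu : Z \in unitmx.
Local Notation S := {mpoly K[3]}.
Local Notation z := (coord_form Z).
Local Notation fc := (form_coef Z).

(* Restriction to the plane [z_0 = c], in the coordinates [z_1, z_2]. *)
Definition dehomog (c : K) (p : S) : {mpoly K[2]} := p \mPo [tuple
  (c * invmx Z o0 i)%:MP + (invmx Z o1 i *: 'X_ord0 + invmx Z o2 i *: 'X_ord_max) | i < 3].

HB.instance Definition _ c := GRing.RMorphism.copy (dehomog c) (comp_mpoly
  [tuple (c * invmx Z o0 i)%:MP + (invmx Z o1 i *: 'X_ord0 + invmx Z o2 i *: 'X_ord_max)
   | i < 3]).

Lemma dehomogX c i : dehomog c 'X_i = (c * invmx Z o0 i)%:MP +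
  (invmx Z o1 i *: 'X_ord0 + invmx Z o2 i *: 'X_ord_max).
Proof. by rewrite /dehomog comp_mpolyXU -tnth_nth tnth_mktuple. Qed.

Lemma dehomogZ c a p : dehomog c (a *: p) = a *: dehomog c p.
Proof. exact: comp_mpolyZ. Qed.

Lemma dehomog_form c p : p \is 1.-homog ->
  dehomog c p = (c * fc p o0)%:MP + (fc p o1 *: 'X_ord0 + fc p o2 *: 'X_ord_max).
Proof.
move=> hp; rewrite [in LHS](linear_formE hp) rmorph_sum /=.
under eq_bigr do rewrite dehomogZ dehomogX !scalerDr.
rewrite !big_split /= /form_coef mulr_sumr !scaler_suml rmorph_sum.
congr (_ + (_ + _)); apply: eq_bigr => i _; last first.
- by rewrite scalerA mulrC.
- by rewrite scalerA mulrC.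
by rewrite /= mulrA -mul_mpolyC -mpolyCM mulrC.
Qed.

Lemma dehomog_coord c :
  [/\ dehomog c (z o0) = c%:MP, dehomog c (z o1) = 'X_ord0 & dehomog c (z o2) = 'X_ord_max].
Proof.
rewrite !dehomog_form ?coord_form_homog // !form_coef_coord //=.
by rewrite !scale0r !scale1r !mulr0 mulr1 !mpolyC0 !addr0 !add0r.
Qed.

(** Setting [z_0] to 0 and substituting [z_1], [z_2] back changes [p] by a multiple of [z_0]; this
    is checked on generators and propagated through sums and products. *)
Lemma dehomog0_eq0 p : dehomog 0 p = 0 -> exists q, p = q * z o0.
Proof.
pose lift q : S := q \mPo [tuple z o1; z o2].
have [q eq] : exists q, p - lift (dehomog 0 p) = q * z o0.
  elim/mpoly_ring_ind: p => [c|i|p q [p' ep] [q' eq]|p q [p' ep] [q' eq]].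
  - by exists 0; rewrite /lift /dehomog !comp_mpolyC subrr mul0r.
  - exists (invmx Z o0 i)%:MP; rewrite dehomogX mul0r mpolyC0 add0r.
    rewrite /lift comp_mpolyD !comp_mpolyZ !comp_mpolyXU /=.
    by rewrite (mpolyX_coord Zu) big_ord3 addrK mul_mpolyC.
  - by exists (p' + q'); rewrite mulrDl -ep -eq rmorphD /lift comp_mpolyD opprD addrACA.
  - exists (p' * q + lift (dehomog 0 p) * q').
    rewrite mulrDl mulrAC -ep -mulrA -eq rmorphM /lift rmorphM /=; ring.
move=> e0; exists q; rewrite -eq e0 /lift comp_mpoly0 subr0 //.
Qed.

(** As [msize] is the degree plus one, this makes [dehomog 0 p] the degree-[e] part of
    [dehomog 1 p], with a remainder of degree below [e]. *)
Let top e p := (msize (dehomog 1 p - dehomog 0 p) <= e)%N /\ dehomog 0 p \is e.-homog.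

Let msizeD_bound k (p q : {mpoly K[2]}) :
  (msize p <= k)%N -> (msize q <= k)%N -> (msize (p + q) <= k)%N.
Proof. by move=> hp hq; apply: leq_trans (msizeD_le _ _) _; rewrite geq_max hp. Qed.

Let dhomog_msize_le e (p : {mpoly K[2]}) : p \is e.-homog -> (msize p <= e.+1)%N.
Proof.
move=> hp; have [->|pn0] := eqVneq p 0; first by rewrite msize0.
by rewrite -[p]addr0 (dhomog_msize_neq0 hp) // msize0.
Qed.

Let topM a p c q : top a p -> top c q -> top (a + c) (p * q).
Proof.
move=> [sp hp] [sq hq]; split; last by rewrite rmorphM; apply: dhomogM.
rewrite !rmorphM /=.
have -> : dehomog 1 p * dehomog 1 q - dehomog 0 p * dehomog 0 q =
    (dehomog 1 p - dehomog 0 p) * (dehomog 1 q - dehomog 0 q) +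
    ((dehomog 1 p - dehomog 0 p) * dehomog 0 q +
     dehomog 0 p * (dehomog 1 q - dehomog 0 q)).
  by move: (dehomog 1 p) (dehomog 1 q) (dehomog 0 p) (dehomog 0 q) => *; ring.
have szM (x y : {mpoly K[2]}) k l m : (msize x <= k)%N -> (msize y <= l)%N ->
    ((k + l).-1 <= m)%N -> (msize (x * y) <= m)%N.
  move=> hx hy; apply: leq_trans.
  have [->|x0] := eqVneq x 0; first by rewrite mul0r msize0.
  have [->|y0] := eqVneq y 0; first by rewrite mulr0 msize0.
  by rewrite msizeM // -!subn1 leq_sub2r // leq_add.
have hp1 := dhomog_msize_le hp; have hq1 := dhomog_msize_le hq.
apply: msizeD_bound; first by apply: szM sp sq _; apply: leq_pred.
by apply: msizeD_bound; [apply: szM sp hq1 _ | apply: szM hp1 sq _];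
  rewrite ?addnS ?addSn.
Qed.

Lemma dehomog_top e p : p \is e.-homog -> top e p.
Proof.
move=> hp; rewrite [p]mpolyE big_seq.
elim/big_ind: _ => [|x y [sx hx] [sy hy]|m /(dhomog_mf hp) /= em].
- by rewrite /top !rmorph0 subrr msize0 dhomog0.
- split; last by rewrite rmorphD dhomogD.
  by rewrite !rmorphD opprD addrACA; apply: msizeD_bound.
suff [sm hm] : top e 'X_[m].
  split; last by rewrite dehomogZ dhomogZ.
  by rewrite !dehomogZ -scalerBr; apply: leq_trans (msizeZ_le _ _) _.
have top1 : top 0 1 by rewrite /top !rmorph1 subrr msize0 dhomog1.
rewrite mpolyXE_id -em mdegE.
elim/big_ind2: _ => // [a q1 c q2 h1 h2|i _]; first exact: topM.
elim: (m i) => [|k IHk]; first by rewrite expr0.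
rewrite exprS -addn1 addnC; apply: topM => //.
rewrite /top !dehomogX mul0r mpolyC0 add0r addrK mmeasureC; split.
  by rewrite /=; case: (_ == 0).
by apply: rpredD; rewrite dhomogZ // dhomogX /= mdeg1.
Qed.

Lemma msize_dehomog e p : p \is e.-homog -> dehomog 0 p != 0 ->
  msize (dehomog 1 p) = e.+1.
Proof.
move=> /dehomog_top [sz hom] n0.
by rewrite -[dehomog 1 p](subrK (dehomog 0 p)) addrC; apply: dhomog_msize_neq0.
Qed.

End Dehomogenization.

(** * The affine lines and their intersection points *)

Lemma linear_system2_eq0 (F : fieldType) (r1 s1 r2 s2 x y : F) :
  r1 * x + s1 * y = 0 -> r2 * x + s2 * y = 0 -> r1 * s2 != r2 * s1 -> x = 0 /\ y = 0.
Proof.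
move=> E1 E2; rewrite -subr_eq0 => d0; split; apply: (mulfI d0); rewrite mulr0.
  transitivity (s2 * (r1 * x + s1 * y) - s1 * (r2 * x + s2 * y)); first by ring.
  by rewrite E1 E2 !mulr0 subrr.
transitivity (r1 * (r2 * x + s2 * y) - r2 * (r1 * x + s1 * y)); first by ring.
by rewrite E1 E2 !mulr0 subrr.
Qed.

Section Geometry.
Context {K : fieldType} (Z : 'M[K]_3) (A : {fset {vspace 'rV[K]_3}}).
Context (alpha : {vspace 'rV[K]_3} -> {mpoly K[3]}) (H0 : {vspace 'rV[K]_3}).
Hypothesis dimA : forall H, H \in A -> \dim H = 2%N.
Hypothesis alpha_def : forall H, H \in A -> defining_form H (alpha H).
Hypothesis H0A : H0 \in A.
Hypothesis adaptedZ : adapted_coordinates H0 Z.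
Local Notation z := (coord_form Z).
Local Notation c H := (form_coef Z (alpha H) o0).
Local Notation r H := (form_coef Z (alpha H) o1).
Local Notation s H := (form_coef Z (alpha H) o2).
Implicit Types (H : {vspace 'rV[K]_3}) (u : 'rV[K]_2) (v : 'rV[K]_3).

Let Zu : Z \in unitmx. Proof. by case: adaptedZ. Qed.
Let H0P v : (v \in H0) = ((v *m Z) 0 o0 == 0). Proof. by case: adaptedZ. Qed.

Lemma alpha_homog H : H \in A -> alpha H \is 1.-homog.
Proof. by move=> /alpha_def []. Qed.

Lemma meval_form v p : p \is 1.-homog ->
  p.@[v 0] = \sum_j form_coef Z p j * (v *m Z) 0 j.
Proof.
move=> /(form_coefE Zu) {1}->; rewrite raddf_sum; apply: eq_bigr => j _ /=.
rewrite mevalZ raddf_sum mxE; congr (_ * _); apply: eq_bigr => i _ /=.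
by rewrite mevalZ mevalXU mulrC.
Qed.

Lemma mem_hyperplane H v : H \in A ->
  (v \in H) = (c H * (v *m Z) 0 o0 + (r H * (v *m Z) 0 o1 + s H * (v *m Z) 0 o2) == 0).
Proof.
move=> HA; have [hom zl] := alpha_def HA.
have := congr1 (fun X : set 'rV[K]_3 => X v) zl.
rewrite /zero_locus /= meval_form // big_ord3 => e.
by apply/idP/eqP => [|h]; [rewrite -e | rewrite e in h].
Qed.

Lemma eq_hyperplane H H' : H \in A -> H' \in A -> {subset H <= H'} -> H = H'.
Proof.
move=> HA H'A sub; apply/eqP; rewrite eqEdim !dimA // leqnn andbT.
exact/subvP.
Qed.

Lemma alpha_H0 : exists2 u0, u0 != 0 & alpha H0 = u0 *: z o0.
Proof.
have unitE j v : (v *m Z) = delta_mx 0 j -> forall k, (v *m Z) 0 k = (k == j)%:R.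
  by move=> -> k; rewrite mxE.
have ex j : exists v, v *m Z = delta_mx 0 j :> 'rV_3.
  by exists (delta_mx 0 j *m invmx Z); rewrite mulmxKV.
have [v0 /unitE E0] := ex o0; have [v1 /unitE E1] := ex o1.
have [v2 /unitE E2] := ex o2.
have := mem_hyperplane v0 H0A; have := mem_hyperplane v1 H0A.
have := mem_hyperplane v2 H0A.
rewrite !H0P !E0 !E1 !E2 /= !eqxx !mulr0 !mulr1 !addr0 !add0r oner_eq0.
move=> /esym/eqP s0 /esym/eqP r0 /esym/negbT u0; exists (c H0) => //.
by rewrite [LHS](form_coefE Zu) ?alpha_homog // big_ord3 r0 s0 !scale0r !addr0.
Qed.

(** With both coefficients zero, the equation of [H] would be a multiple of [z_0], so [H] would
    contain [H0] and equal it by dimension. *)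
Lemma direction_neq0 H : H \in A -> H != H0 -> (r H != 0) || (s H != 0).
Proof.
move=> HA; apply: contraNT; rewrite negb_or !negbK => /andP [/eqP r0 /eqP s0].
apply/eqP/esym; apply: eq_hyperplane => // v; rewrite H0P mem_hyperplane // => /eqP ->.
by rewrite r0 s0 !mul0r mulr0 !addr0.
Qed.

Definition lift_point u : 'rV[K]_3 := row_mx (const_mx 1 : 'rV_1) u *m invmx Z.

Lemma lift_point_coord u : [/\ (lift_point u *m Z) 0 o0 = 1,
  (lift_point u *m Z) 0 o1 = u 0 ord0 & (lift_point u *m Z) 0 o2 = u 0 ord_max].
Proof.
rewrite mulmxKV //; split.
- transitivity (row_mx (const_mx 1 : 'rV_1) u 0 (lshift 2 ord0)).
    by congr (row_mx _ _ _ _); apply: val_inj.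
  by rewrite row_mxEl mxE.
- transitivity (row_mx (const_mx 1 : 'rV_1) u 0 (rshift 1 ord0)).
    by congr (row_mx _ _ _ _); apply: val_inj.
  by rewrite row_mxEr.
- transitivity (row_mx (const_mx 1 : 'rV_1) u 0 (rshift 1 ord_max)).
    by congr (row_mx _ _ _ _); apply: val_inj.
  by rewrite row_mxEr.
Qed.

Lemma mem_lift_point H u : H \in A ->
  (lift_point u \in H) = (c H + (r H * u 0 ord0 + s H * u 0 ord_max) == 0).
Proof.
by move=> HA; rewrite mem_hyperplane //; have [-> -> ->] := lift_point_coord u; rewrite mulr1.
Qed.

Lemma affine_traceP H u : affine_trace Z H u <-> lift_point u \in H.
Proof.
split=> [[v vH ev]|uH]; first by rewrite /lift_point -ev mulmxK.
by exists (lift_point u); rewrite // mulmxKV.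
Qed.

Lemma meval_dehomog p u : p \is 1.-homog ->
  (dehomog Z 1 p).@[u 0] =
  form_coef Z p o0 + (form_coef Z p o1 * u 0 ord0 + form_coef Z p o2 * u 0 ord_max).
Proof.
move=> hp; rewrite dehomog_form // mul1r !mevalD mevalC !mevalZ !mevalXU.
by congr (_ + (_ + _ * u _ _)).
Qed.

Lemma meval_dehomog_eq0 H u : H \in A ->
  ((dehomog Z 1 (alpha H)).@[u 0] == 0) = (lift_point u \in H).
Proof. by move=> HA; rewrite meval_dehomog ?alpha_homog // mem_lift_point. Qed.

Lemma lift_point_notin_H0 u : lift_point u \notin H0.
Proof. by rewrite H0P; have [-> _ _] := lift_point_coord u; rewrite oner_eq0. Qed.

(** Subtracting from a vector of [H] a multiple of [lift_point u] brings it into [z_0 = 0], where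
    the equations of [H] and [H'] involve only their [r] and [s]. If these were proportional, the
    vector would lie in [H'] as well, forcing [H = H']. *)
Lemma directions_independent H H' u : H \in A -> H' \in A -> lift_point u \in H ->
  lift_point u \in H' -> H != H' -> r H * s H' != r H' * s H.
Proof.
move=> HA H'A uH uH'; apply: contraNneq => det0; apply/eqP/eq_hyperplane => // v.
have HnH0 : H != H0 by apply: contraTneq uH => ->; apply: lift_point_notin_H0.
rewrite !mem_hyperplane //; move: uH uH'; rewrite !mem_lift_point //.
set w0 := (_ *m _) _ o0; set w1 := (_ *m _) _ o1; set w2 := (_ *m _) _ o2.
set x := u _ _; set y := u _ _ => /eqP uH /eqP uH' /eqP vH.
have {}vH : r H * (w1 - w0 * x) + s H * (w2 - w0 * y) = 0.
  by rewrite -[RHS](subrr 0) -{1}vH -(mulr0 w0) -uH; ring.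
suff e : r H' * (w1 - w0 * x) + s H' * (w2 - w0 * y) = 0.
  by apply/eqP; rewrite -[RHS]addr0 -{1}e -(mulr0 w0) -uH'; ring.
have er : r H * (r H' * (w1 - w0 * x) + s H' * (w2 - w0 * y)) = 0.
  by rewrite mulrDr [r H * (s H' * _)]mulrA det0 -[RHS](mulr0 (r H')) -vH; ring.
have es : s H * (r H' * (w1 - w0 * x) + s H' * (w2 - w0 * y)) = 0.
  by rewrite mulrDr [s H * (r H' * _)]mulrA [s H * r H']mulrC -det0 -[RHS](mulr0 (s H')) -vH; ring.
have /orP [n0|n0] := direction_neq0 HA HnH0; apply/eqP.
  by move/eqP: er; rewrite mulf_eq0 (negbTE n0).
by move/eqP: es; rewrite mulf_eq0 (negbTE n0).
Qed.

(** A vector of [H] outside [H0] can be rescaled into [z_0 = 1], so the trace determines it. A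
    vector [v] of [H] inside [H0] is [(v + w) - w] with [w] in [H] outside [H0]. *)
Lemma affine_trace_inj H H' : H \in A -> H' \in A -> H != H0 ->
  affine_trace Z H = affine_trace Z H' -> H = H'.
Proof.
move=> HA H'A HnH0 e; apply: eq_hyperplane => //.
have sub1 v : v \in H -> v \notin H0 -> v \in H'.
  move=> vH; rewrite H0P; set t := (v *m Z) 0 o0 => t0.
  have ev : t^-1 *: v = lift_point (rsubmx (t^-1 *: v *m Z : 'rV_(1 + 2))).
    apply: (canRL (mulmxK Zu)).
    apply: etrans (esym (@hsubmxK _ 1 1 2 (t^-1 *: v *m Z))) _; congr (row_mx _ _).
    apply/rowP => i; rewrite ord1 [RHS]mxE -scalemxAl [LHS]mxE [LHS]mxE.
    by rewrite -[RHS](mulVf t0); congr (_ * (v *m Z) _ _); apply: val_inj.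
  suff : t^-1 *: v \in H'.
    by move=> tv; rewrite -[v](scalerKV t0) memvZ.
  by rewrite ev; apply/affine_traceP; rewrite -e; apply/affine_traceP; rewrite -ev memvZ.
have /subvPn [w wH wH0] : ~~ (H <= H0)%VS.
  by apply: contraNN HnH0 => /subvP sub; apply/eqP/eq_hyperplane.
move=> v vH; have [vH0|] := boolP (v \in H0); last exact: sub1.
rewrite -[v](addrK w); apply: rpredB; last exact: sub1.
apply: sub1; first exact: rpredD.
by apply: contraNN wH0 => vw; rewrite -[w](addrK v) [w + v]addrC; apply: rpredB.
Qed.

Lemma mem_decone l : reflect (exists2 H, H \in A & H != H0 /\ l = affine_trace Z H)
  (l \in decone Z A H0).
Proof.
rewrite /decone; apply: (iffP (imfsetP _ _ _ _)) => [[H /=]|[H HA [ne ->]]].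
  by rewrite !inE => /andP [ne HA] ->; exists H.
by exists H => //=; rewrite !inE ne.
Qed.

(** Replaces lines by planes. A plane through [lift_point u] differs from [H0], and two distinct
    ones have independent directions, so their traces meet only at [u]. *)
Lemma intersection_pointsP u : intersection_points (decone Z A H0) u <->
  exists H H', [/\ H \in A, H' \in A, H != H', lift_point u \in H & lift_point u \in H'].
Proof.
split=> [[l [l' [/mem_decone [H HA [ne ->]] /mem_decone [H' H'A [ne' ->]] nl e]]]|].
  have [tH tH'] : (affine_trace Z H `&` affine_trace Z H') u by rewrite e.
  exists H, H'; split=> //; try exact/affine_traceP.
  by apply: contraNneq nl => ->.
move=> [H [H' [HA H'A ne uH uH']]].
have neH0 (G : {vspace 'rV[K]_3}) : lift_point u \in G -> G != H0.
  by apply: contraTneq => ->; apply: lift_point_notin_H0.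
exists (affine_trace Z H), (affine_trace Z H'); split.
- by apply/mem_decone; exists H; rewrite // neH0.
- by apply/mem_decone; exists H'; rewrite // neH0.
- by apply: contraNneq ne => /affine_trace_inj ->; rewrite ?neH0.
apply/seteqP; split=> [u' []|u' ->]; last by split; apply/affine_traceP.
move=> /affine_traceP u'H /affine_traceP u'H'.
have det := directions_independent HA H'A uH uH' ne.
move: uH uH' u'H u'H'; rewrite !mem_lift_point // => /eqP uH /eqP uH' /eqP u'H /eqP u'H'.
have E G : c G + (r G * u 0 ord0 + s G * u 0 ord_max) = 0 ->
    c G + (r G * u' 0 ord0 + s G * u' 0 ord_max) = 0 ->
    r G * (u' 0 ord0 - u 0 ord0) + s G * (u' 0 ord_max - u 0 ord_max) = 0.
  move=> uG u'G; transitivity (c G + (r G * u' 0 ord0 + s G * u' 0 ord_max)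
    - (c G + (r G * u 0 ord0 + s G * u 0 ord_max))); first by ring.
  by rewrite uG u'G subrr.
have [/subr0_eq e0 /subr0_eq e1] := linear_system2_eq0 (E _ uH u'H) (E _ uH' u'H') det.
apply/rowP => i; case: (unliftP ord0 i) => [j|] -> //.
by rewrite (_ : lift ord0 j = ord_max) //; apply: val_inj; case: j => [[]].
Qed.

Lemma mu_decone u : mu (decone Z A H0) u =
  (size [seq H : {vspace 'rV[K]_3} <- enum_fset A | lift_point u \in H]).-1.
Proof.
rewrite /mu subn1; congr _.-1.
pose L := [fset H in A | lift_point u \in H]%fset.
have -> : [fset l in decone Z A H0 | u \in l]%fset = [fset affine_trace Z H | H in L]%fset.
  apply/fsetP => l; rewrite !inE; apply/andP/imfsetP => [[/mem_decone [H HA [ne ->]]]|[H /=]].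
    by move=> /set_mem/affine_traceP uH; exists H => //=; rewrite !inE HA.
  rewrite !inE => /andP [HA uH] ->; split; last exact/affine_traceP.
  apply/mem_decone; exists H => //; split=> //.
  by apply: contraTneq uH => ->; apply: lift_point_notin_H0.
rewrite card_in_imfset /=; last first.
  move=> H H'; rewrite !inE => /andP [HA uH] /andP [H'A _]; apply: affine_trace_inj => //.
  by apply: contraTneq uH => ->; apply: lift_point_notin_H0.
apply: perm_size; apply: uniq_perm.
- exact: fset_uniq.
- by rewrite filter_uniq // fset_uniq.
- by move=> H; rewrite mem_filter !inE andbC.
Qed.

End Geometry.

(** * The two curves *)

Section Translation.
Context {K : fieldType} (u : 'rV[K]_2).

(** The substitution inside [germ], named so that it can carry a ring morphism structure. *)
Definition translate (f : {mpoly K[2]}) : {mpoly K[2]} :=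
  f \mPo [tuple 'X_i + (u 0 i)%:MP | i < 2].

HB.instance Definition _ := GRing.RMorphism.copy translate
  (comp_mpoly [tuple 'X_i + (u 0 i)%:MP | i < 2]).

Lemma translateX i : translate 'X_i = 'X_i + (u 0 i)%:MP.
Proof. by rewrite /translate comp_mpolyXU -tnth_nth tnth_mktuple. Qed.

Lemma translateZ a f : translate (a *: f) = a *: translate f.
Proof. exact: comp_mpolyZ. Qed.

Lemma translateC a : translate a%:MP = a%:MP.
Proof. exact: comp_mpolyC. Qed.

Lemma mcoeff0_translate f : (translate f)@_0%MM = f.@[u 0].
Proof.
elim/mpoly_ring_ind: f => [a|i|f g ef eg|f g ef eg].
- by rewrite translateC mcoeffC eqxx mulr1 mevalC.
- by rewrite translateX mcoeffD mcoeffX mnm1_eq0 add0r mcoeffC eqxx mulr1 mevalXU.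
- by rewrite rmorphD mcoeffD mevalD ef eg.
- by rewrite !rmorphM /= ef eg.
Qed.

End Translation.

Section Curves.
Context {K : fieldType} (Z : 'M[K]_3) (A : {fset {vspace 'rV[K]_3}}).
Context (alpha : {vspace 'rV[K]_3} -> {mpoly K[3]}) (H0 : {vspace 'rV[K]_3}).
Hypothesis dimA : forall H, H \in A -> \dim H = 2%N.
Hypothesis alpha_def : forall H, H \in A -> defining_form H (alpha H).
Hypothesis H0A : H0 \in A.
Hypothesis adaptedZ : adapted_coordinates H0 Z.
Context (e1 e2 : nat) (g1 h1 g2 h2 : {mpoly K[3]}).
Hypothesis basis : log_pair_basis Z A alpha e1 e2 g1 h1 g2 h2.
Context (b : K).
Local Notation S := {mpoly K[3]}.
Local Notation z := (coord_form Z).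
Local Notation r H := (form_coef Z (alpha H) o1).
Local Notation s H := (form_coef Z (alpha H) o2).
Hypothesis b_generic : forall H, H \in A -> H != H0 -> s H - b * r H != 0.
Local Notation phi := (dehomog Z 1).
Implicit Types (H : {vspace 'rV[K]_3}) (u : 'rV[K]_2) (g h : S).

Let Zu : Z \in unitmx. Proof. by case: adaptedZ. Qed.
Let hom := alpha_homog alpha_def.

Let f1 := phi (g1 + b *: h1).
Let f2 := phi (g2 + b *: h2).

(** The expression [g + b h] is linear in the pair, so expanding a logarithmic pair in the basis
    puts it in the ideal of the two curves. Every membership below comes from a well-chosen pair. *)
Let log_pair_ideal g h : log_pair Z A alpha g h -> ideal2 f1 f2 (phi (g + b *: h)).
Proof.
move=> /(log_basis_span basis) [c1 [c2 [-> ->]]].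
exists (phi c1), (phi c2); rewrite -!rmorphM -rmorphD; congr (phi _).
by rewrite scalerDr !scalerAr !mulrDr addrACA.
Qed.

Let lines u := [seq H : {vspace 'rV[K]_3} <- enum_fset A | lift_point Z u \in H].
Let others u := [seq H : {vspace 'rV[K]_3} <- enum_fset A | lift_point Z u \notin H].

Let mem_lines u H : (H \in lines u) = (lift_point Z u \in H) && (H \in A).
Proof. by rewrite mem_filter. Qed.

Let mem_others u H : (H \in others u) = (lift_point Z u \notin H) && (H \in A).
Proof. by rewrite mem_filter. Qed.

Let neH0 u H : lift_point Z u \in H -> H != H0.
Proof. by apply: contraTneq => ->; apply: (lift_point_notin_H0 adaptedZ). Qed.

Let dvd_prod (l : seq {vspace 'rV[K]_3}) H : H \in l ->
  exists q, \prod_(G <- l) alpha G = q * alpha H.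
Proof. by move=> Hl; rewrite (big_rem H) //= mulrC; eexists. Qed.

(** Puts the product of all the forms in the ideal, so that a common zero of the curves lies on some
    line. *)
Let log_pair_all : log_pair Z A alpha (\prod_(H <- enum_fset A) alpha H) 0.
Proof.
move=> H HA; have [q ->] := dvd_prod HA.
by exists (r H *: q); rewrite scaler0 addr0 scalerAl.
Qed.

(** The constant field [(s, - r)] kills the form of [H1]; multiplying by the other forms makes it
    tangent to the other planes. *)
Let log_pair_along H1 (l : seq {vspace 'rV[K]_3}) :
    (forall H, H \in A -> H != H1 -> H \in l) ->
  log_pair Z A alpha (s H1 *: \prod_(H <- l) alpha H) (- r H1 *: \prod_(H <- l) alpha H).
Proof.
move=> sub H HA; have [->|ne] := eqVneq H H1.
  by exists 0; rewrite mul0r !scalerA -scalerDl mulrN mulrC subrr scale0r.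
have [q ->] := dvd_prod (sub H HA ne).
exists (r H *: (s H1 *: q) + s H *: (- r H1 *: q)).
by rewrite mulrDl -!scalerAl.
Qed.

(** The Euler field centred at [u], homogenized: it reproduces the form of every plane through
    [lift_point u], and the factor [q] takes care of the other planes. *)
Let log_pair_euler u (q := \prod_(H <- others u) alpha H) :
  log_pair Z A alpha (q * (z o1 - u 0 ord0 *: z o0)) (q * (z o2 - u 0 ord_max *: z o0)).
Proof.
move=> H HA; have [uH|uH] := boolP (lift_point Z u \in H).
  exists q; rewrite !scalerAr -mulrDr; congr (q * _).
  rewrite [RHS](form_coefE Zu) ?hom // big_ord3.
  move: uH; rewrite (mem_lift_point alpha_def adaptedZ) // addr_eq0 => /eqP ->.
  rewrite -!mul_mpolyC !mpolyCN !mpolyCD !mpolyCM; ring.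
have [q' ->] : exists q', q = q' * alpha H by apply: dvd_prod; rewrite mem_others uH.
exists (r H *: (q' * (z o1 - u 0 ord0 *: z o0)) + s H *: (q' * (z o2 - u 0 ord_max *: z o0))).
by rewrite mulrDl -!scalerAl; congr (_ *: _ + _ *: _); rewrite mulrAC.
Qed.

Let meval_prod_neq0 u : (phi (\prod_(H <- others u) alpha H)).@[u 0] != 0.
Proof.
rewrite !rmorph_prod /= prodf_seq_neq0; apply/allP => H; rewrite mem_others /=.
by move=> /andP [uH HA]; rewrite (meval_dehomog_eq0 alpha_def adaptedZ).
Qed.

Let meval_ideal0 u p : f1.@[u 0] = 0 -> f2.@[u 0] = 0 -> ideal2 f1 f2 p -> p.@[u 0] = 0.
Proof. by move=> z1 z2 [x [y ->]]; rewrite mevalD !mevalM z1 z2 !mulr0 addr0. Qed.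

(** At a point on two lines, tangency gives two independent linear equations for the values of [g]
    and [h]. *)
Let log_pair_vanish u g h : log_pair Z A alpha g h ->
  intersection_points (decone Z A H0) u -> (phi (g + b *: h)).@[u 0] = 0.
Proof.
move=> lgh /(intersection_pointsP dimA alpha_def H0A adaptedZ) [H [H' [HA H'A ne uH uH']]].
have det := directions_independent dimA alpha_def H0A adaptedZ HA H'A uH uH' ne.
have E G : G \in A -> lift_point Z u \in G ->
    r G * (phi g).@[u 0] + s G * (phi h).@[u 0] = 0.
  move=> GA uG; have [q eq] := lgh G GA.
  rewrite -!mevalZ -mevalD -!dehomogZ -rmorphD eq rmorphM mevalM.
  by move: uG; rewrite -(meval_dehomog_eq0 alpha_def adaptedZ) // => /eqP ->; rewrite mulr0.
have [zg zh] := linear_system2_eq0 (E H HA uH) (E H' H'A uH') det.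
by rewrite rmorphD /= dehomogZ mevalD mevalZ zg zh mulr0 addr0.
Qed.

(** At a common zero the whole ideal vanishes. The product of all forms yields one line through the
    point; the field along that line then forces another form to vanish there. *)
Lemma curves_zero_locus :
  zero_locus f1 `&` zero_locus f2 = intersection_points (decone Z A H0).
Proof.
apply/seteqP; split=> u; last first.
  by move=> hu; split; apply: log_pair_vanish hu;
    [apply: log_basis_log1 basis | apply: log_basis_log2 basis].
move=> [/= z1 z2]; apply/(intersection_pointsP dimA alpha_def H0A adaptedZ).
have [H1 H1A uH1] : exists2 H, H \in A & lift_point Z u \in H.
  have /eqP := meval_ideal0 z1 z2 (log_pair_ideal log_pair_all).
  rewrite scaler0 addr0 !rmorph_prod /= prodf_seq_eq0 => /hasP [H HA].
  by rewrite /= (meval_dehomog_eq0 alpha_def adaptedZ) //; exists H.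
(* The forms nonzero at [u] are kept apart, so the vanishing factor must come from another plane
   through [lift_point u]. *)
pose l := rem H1 (lines u) ++ others u.
have sub H : H \in A -> H != H1 -> H \in l.
  move=> HA ne; rewrite mem_cat mem_others HA andbT orbC.
  case: (boolP (_ \in H)) => //= uH.
  by rewrite mem_rem_uniq ?filter_uniq ?fset_uniq // !inE ne mem_lines uH.
have /eqP := meval_ideal0 z1 z2 (log_pair_ideal (log_pair_along sub)).
rewrite scalerA -scalerDl mulrN dehomogZ mevalZ mulf_eq0 (negbTE (b_generic _ _)) ?neH0 //=.
  rewrite /l big_cat rmorphM mevalM mulf_eq0 (negbTE (meval_prod_neq0 u)) orbF.
  rewrite !rmorph_prod /= prodf_seq_eq0 => /hasP [H].
  rewrite mem_rem_uniq ?filter_uniq ?fset_uniq // !inE mem_lines => /and3P [ne uH HA] _.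
  by exists H, H1.
exact: neH0 uH1.
Qed.

Let translate_alpha u H : H \in A -> lift_point Z u \in H ->
  translate u (phi (alpha H)) = r H *: 'X_ord0 + s H *: 'X_ord_max.
Proof.
move=> HA; rewrite (mem_lift_point alpha_def adaptedZ) // => /eqP uH.
rewrite dehomog_form ?hom // mul1r !rmorphD /= translateC !translateZ !translateX.
rewrite !scalerDr addrACA addrA -[RHS]add0r -[0 in RHS]mpolyC0 -uH !mpolyCD !mpolyCM !mul_mpolyC.
by rewrite -!mul_mpolyC; ring.
Qed.

Lemma curves_intersection_mult u : intersection_points (decone Z A H0) u ->
  intersection_mult_is u f1 f2 (mu (decone Z A H0) u).
Proof.
move=> /(intersection_pointsP dimA alpha_def H0A adaptedZ) [H1 [_ [H1A _ _ uH1 _]]].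
rewrite (mu_decone dimA H0A adaptedZ) -/(lines u).
set n := (size _).-1.
rewrite /intersection_mult_is /germ -/(translate u f1) -/(translate u f2).
set I := ideal2 _ _.
have idealI p : ideal2 f1 f2 p -> I (ps_of_mpoly (translate u p)).
  move=> [x [y ->]]; exists (ps_of_mpoly (translate u x)), (ps_of_mpoly (translate u y)).
  by rewrite -!ps_of_mpolyM -ps_of_mpolyD -!rmorphM -rmorphD.
pose q := phi (\prod_(H <- others u) alpha H).
(* The germ of [q] is a unit because [q] does not vanish at [u], so it can be cancelled. *)
have q_unit p : I (ps_of_mpoly (translate u q * p)) -> I (ps_of_mpoly p).
  move=> Iqp; have [|v ev] := @ps_of_mpoly_inv _ _ (translate u q).
    by rewrite mcoeff0_translate; apply: meval_prod_neq0.
  by rewrite -[ps_of_mpoly p]mul1r -ev -mulrA -ps_of_mpolyM; apply: ideal2M.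
(* The centred Euler field gives [q (x + b y)]. *)
have I_line : I (ps_of_mpoly ('X_ord0 + b *: 'X_ord_max)).
  apply: q_unit; have := idealI _ (log_pair_ideal (@log_pair_euler u)).
  rewrite scalerAr -mulrDr !rmorphM rmorphD /= dehomogZ !rmorphB /= !dehomogZ.
  have [-> -> ->] := dehomog_coord Zu 1.
  rewrite rmorphD /= translateZ !rmorphB /= !translateZ !translateX translateC.
  by rewrite -!mul_mpolyC !mulr1 !addrK.
have lines_uniq : uniq (lines u) by rewrite filter_uniq // fset_uniq.
(* The field along [H1] gives, up to a unit, the product of the [n] forms of the other lines through
   [u]. *)
have I_power : I (ps_of_mpoly ('X_ord_max ^+ n)).
  pose l := rem H1 (lines u).
  have sub H : H \in A -> H != H1 -> H \in others u ++ l.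
    move=> HA ne; rewrite mem_cat mem_others HA andbT.
    case: (boolP (_ \in H)) => //= uH.
    by rewrite mem_rem_uniq // !inE ne mem_lines uH.
  have lA H : H \in l -> lift_point Z u \in H /\ H \in A.
    by move/mem_rem; rewrite mem_lines => /andP.
  have := idealI _ (log_pair_ideal (log_pair_along sub)).
  rewrite scalerA -scalerDl mulrN dehomogZ translateZ big_cat !rmorphM scalerAr.
  move/q_unit; rewrite !rmorph_prod /=.
  have -> : \prod_(H <- l) translate u (phi (alpha H)) =
      \prod_(H <- l) (r H *: 'X_ord0 + s H *: 'X_ord_max).
    rewrite big_seq [RHS]big_seq; apply: eq_bigr => H /lA [uH HA].
    exact: translate_alpha.
  have nz1 : s H1 - b * r H1 != 0 by apply: b_generic => //; apply: neH0 uH1.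
  rewrite ps_of_mpolyZ => /(ideal2M (ps_of_mpoly (s H1 - b * r H1)^-1%:MP)).
  rewrite -ps_scaleE scalerA mulVf // scale1r => Iprod.
  (* Modulo [x + b y], each such form is a multiple of [y], nonzero for the planes in [l] by
     genericity of [b]. *)
  have Icongr H : I (ps_of_mpoly (r H *: 'X_ord0 + s H *: 'X_ord_max)
                     - ps_of_mpoly ((s H - b * r H) *: 'X_ord_max)).
    rewrite -ps_of_mpolyN -ps_of_mpolyD.
    have -> : r H *: 'X_ord0 + s H *: 'X_ord_max + - ((s H - b * r H) *: 'X_ord_max)
       = (r H)%:MP * ('X_ord0 + b *: 'X_ord_max) :> {mpoly K[2]}.
      by rewrite -!mul_mpolyC mpolyCB mpolyCM; ring.
    by rewrite ps_of_mpolyM; apply: ideal2M.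
  have psprod (F : {vspace 'rV[K]_3} -> {mpoly K[2]}) :
      ps_of_mpoly (\prod_(H <- l) F H) = \prod_(H <- l) ps_of_mpoly (F H).
    exact: (big_morph _ (@ps_of_mpolyM _ _) (@ps_of_mpoly1 _ _)).
  have := ideal2B Iprod (ideal2_congr_prod l Icongr).
  rewrite psprod opprB addrCA subrr addr0 -psprod.
  have -> : \prod_(H <- l) ((s H - b * r H) *: 'X_ord_max) =
      (\prod_(H <- l) (s H - b * r H)) *: 'X_ord_max ^+ n :> {mpoly K[2]}.
    rewrite scaler_prod; congr (_ *: _); rewrite big_const_seq count_predT iter_mulr_1.
    by rewrite size_rem // mem_lines uH1.
  rewrite ps_of_mpolyZ => /(ideal2M (ps_of_mpoly (\prod_(H <- l) (s H - b * r H))^-1%:MP)).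
  rewrite -ps_scaleE scalerA mulVf ?scale1r //.
  rewrite prodf_seq_neq0; apply/allP => H /lA [uH HA] /=.
  by apply: b_generic => //; apply: neH0 uH.
(* After translation the lines of [lines u] pass through the origin, so the bound on the order
   applies to the translated field. *)
have restr0 g h : log_pair Z A alpha g h -> forall j, (j < n)%N ->
    (line_restr (vec2 (- b) 1) (translate u (phi (g + b *: h))))`_j = 0.
  move=> lgh j ltjn; rewrite rmorphD /= dehomogZ rmorphD /= translateZ.
  apply: (@log_field_line_restr _ b _ (lines u) (fun H => r H) (fun H => s H)) => //.
  - by move=> H; rewrite mem_lines => /andP [uH HA]; apply: b_generic => //; apply: neH0 uH.
  - move=> H H'; rewrite !mem_lines => /andP [uH HA] /andP [uH' H'A] ne.
    exact: (directions_independent dimA alpha_def H0A adaptedZ HA H'A uH uH' ne).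
  - move=> H; rewrite mem_lines => /andP [uH HA]; have [k ek] := lgh H HA.
    exists (translate u (phi k)); rewrite -(translate_alpha HA uH) -rmorphM -rmorphM -ek.
    by rewrite !rmorphD /= !dehomogZ !translateZ.
apply: (quotient_dim_line I_line I_power).
- exact: restr0 (log_basis_log1 basis).
- exact: restr0 (log_basis_log2 basis).
Qed.

End Curves.

(** * Degrees of the curves *)

Section Degree.
Context {K : fieldType} (Z : 'M[K]_3) (A : {fset {vspace 'rV[K]_3}}).
Context (alpha : {vspace 'rV[K]_3} -> {mpoly K[3]}) (H0 : {vspace 'rV[K]_3}).
Hypothesis dimA : forall H, H \in A -> \dim H = 2%N.
Hypothesis alpha_def : forall H, H \in A -> defining_form H (alpha H).
Hypothesis H0A : H0 \in A.
Hypothesis adaptedZ : adapted_coordinates H0 Z.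
Local Notation z := (coord_form Z).
Local Notation r H := (form_coef Z (alpha H) o1).
Local Notation s H := (form_coef Z (alpha H) o2).

Let Zu : Z \in unitmx. Proof. by case: adaptedZ. Qed.

Lemma log_pair_basis_swap e1 e2 g1 h1 g2 h2 :
  log_pair_basis Z A alpha e1 e2 g1 h1 g2 h2 ->
  log_pair_basis Z A alpha e2 e1 g2 h2 g1 h1.
Proof.
case=> hom1 hom2 log1 log2 sp fr; split=> //.
  by move=> g h /sp [c1 [c2 [-> ->]]]; exists c2, c1; split; rewrite addrC.
by move=> c1 c2 eg eh; have [] := fr c2 c1; rewrite 1?addrC.
Qed.

(** For [H] other than [H0], the form [alpha H] is nonzero on [z_0 = 0], so [z_0] divides the
    quotient and cancels. For [H0] itself both coefficients [r] and [s] are zero. *)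
Lemma log_pair_divl g h : log_pair Z A alpha (g * z o0) (h * z o0) ->
  log_pair Z A alpha g h.
Proof.
move=> lgh H HA; have [eH|ne] := eqVneq H H0.
  have [u0 _ eu] := alpha_H0 alpha_def H0A adaptedZ.
  have coefE j : form_coef Z (alpha H) j = u0 * (j == o0)%:R.
    rewrite eH eu -(form_coef_coord Zu) /form_coef mulr_sumr.
    by apply: eq_bigr => i _; rewrite mcoeffZ mulrCA.
  by exists 0; rewrite !coefE /= !mulr0 !scale0r addr0 mul0r.
have [k ek] := lgh H HA.
have alphaH_neq0 : dehomog Z 0 (alpha H) != 0.
  rewrite dehomog_form ?(alpha_homog alpha_def) // mul0r mpolyC0 add0r.
  have := direction_neq0 dimA alpha_def H0A adaptedZ HA ne.
  apply: contraTneq => e; rewrite negb_or !negbK; apply/andP; split; apply/eqP.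
    move/(congr1 (mcoeff U_(ord0))): e.
    by rewrite mcoeffD !mcoeffZ !mcoeffXU mcoeff0 /= mulr1 mulr0 addr0.
  move/(congr1 (mcoeff U_(ord_max))): e.
  by rewrite mcoeffD !mcoeffZ !mcoeffXU mcoeff0 /= mulr1 mulr0 add0r.
have [z0E _ _] := dehomog_coord Zu 0.
have /(dehomog0_eq0 Zu) [k' ek'] : dehomog Z 0 k = 0.
  move/(congr1 (dehomog Z 0)): ek.
  rewrite rmorphD /= !dehomogZ !rmorphM /= z0E mpolyC0 !mulr0 !scaler0 addr0.
  by move/esym/eqP; rewrite mulf_eq0 (negbTE alphaH_neq0) orbF => /eqP.
exists k'; apply: (mulIf (coord_form_neq0 Zu o0)).
by rewrite mulrAC -ek' -ek mulrDl -!scalerAl.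
Qed.

(** Otherwise [z_0] divides [g1] and [h1], and the quotient pair is again logarithmic. Expanding it
    in the basis, freeness gives [c1 z_0 = 1], absurd at [z_0 = 0]. *)
Lemma dehomog0_basis_neq0 e1 e2 g1 h1 g2 h2 :
  log_pair_basis Z A alpha e1 e2 g1 h1 g2 h2 ->
  dehomog Z 0 g1 != 0 \/ dehomog Z 0 h1 != 0.
Proof.
move=> B; apply: contrapT => /not_orP [/negP/negPn/eqP zg /negP/negPn/eqP zh].
have [g eg] := dehomog0_eq0 Zu zg; have [h eh] := dehomog0_eq0 Zu zh.
have lgh : log_pair Z A alpha g h.
  by apply: log_pair_divl; rewrite -eg -eh; apply: log_basis_log1 B.
have [c1 [c2 [Eg Eh]]] := log_basis_span B lgh.
have [||e _] := log_basis_free B (c1 := c1 * z o0 - 1) (c2 := c2 * z o0).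
- by rewrite mulrBl mul1r {2}eg Eg; ring.
- by rewrite mulrBl mul1r {2}eh Eh; ring.
have [z0E _ _] := dehomog_coord Zu 0.
move/(congr1 (dehomog Z 0)): e; rewrite rmorphB rmorphM rmorph1 /= z0E mpolyC0 mulr0 add0r rmorph0.
by move/eqP; rewrite oppr_eq0 oner_eq0.
Qed.

End Degree.

(** * Choice of the generic coefficient [b] and conclusion *)

Lemma generic_comb_neq0 (n : nat) (K : fieldType) (p q : {mpoly K[n]}) :
  p != 0 \/ q != 0 -> exists2 P : {poly K}, P != 0 &
    forall b, ~~ root P b -> p + b *: q != 0.
Proof.
move=> pq; have [m pqm] : exists m, (p@_m != 0) || (q@_m != 0).
  by case: pq => /mlead_supp; rewrite mcoeff_msupp => nz;
    eexists; apply/orP; [left|right]; exact: nz.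
(* The coefficient of [p + b q] at [m], as a polynomial in [b]. *)
exists ((p@_m)%:P + q@_m *: 'X).
  apply: contraTneq pqm => e; rewrite negb_or !negbK; apply/andP; split; apply/eqP.
    move/(congr1 (fun P : {poly K} => P`_0)): e.
    by rewrite coefD coefC coefZ coefX mulr0 addr0 coef0.
  by move/(congr1 (fun P : {poly K} => P`_1)): e; rewrite coefD coefC coefZ coefX mulr1 add0r coef0.
move=> b; apply: contraNneq => /(congr1 (mcoeff m)).
by rewrite mcoeffD mcoeffZ mcoeff0 /root !hornerE mulrC => ->.
Qed.

Theorem theorem2p22 (R : realType)
    (A : {fset {vspace 'rV[R[i]]_3}})
    (hA : forall H, H \in A -> \dim H = 2%N)
    (alpha : {vspace 'rV[R[i]]_3} -> {mpoly R[i][3]})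
    (halpha : forall H, H \in A -> defining_form H (alpha H))
    (e1 e2 : nat)
    (hfree : free_with_exponents A alpha [tuple 1%N; e1; e2])
    (H0 : {vspace 'rV[R[i]]_3}) (hH0 : H0 \in A)
    (Z : 'M[R[i]]_3) (hZ : adapted_coordinates H0 Z) :
  let dA := decone Z A H0 in
  exists f1 f2 : {mpoly R[i][2]},
    [/\ msize f1 = e1.+1,
        msize f2 = e2.+1,
        zero_locus f1 `&` zero_locus f2 = intersection_points dA
      & forall p, intersection_points dA p ->
          intersection_mult_is p f1 f2 (mu dA p)].
Proof.
move=> dA; have Zu : Z \in unitmx by case: hZ.
have [u0 u0n0 eu] := alpha_H0 halpha hH0 hZ.
have [g1 [h1 [g2 [h2 B]]]] :=
  free_log_pair_basis Zu (alpha_homog halpha) hH0 u0n0 eu hfree.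
have [P1 P1n0 P1b] := generic_comb_neq0 (dehomog0_basis_neq0 hA halpha hH0 hZ B).
have [P2 P2n0 P2b] := generic_comb_neq0
  (dehomog0_basis_neq0 hA halpha hH0 hZ (log_pair_basis_swap B)).
pose r H := form_coef Z (alpha H) o1; pose s H := form_coef Z (alpha H) o2.
(* Its roots are the values of [b] for which some line has direction [(- b, 1)]. *)
pose Q := \prod_(H <- enum_fset (A `\ H0)%fset) ((s H)%:P - r H *: 'X) : {poly R[i]}.
have Qn0 : Q != 0.
  rewrite prodf_seq_neq0; apply/allP => H; rewrite in_fsetD1 => /andP [ne HA] /=.
  have := direction_neq0 hA halpha hH0 hZ HA ne.
  apply: contraTneq => e; rewrite negb_or !negbK; apply/andP; split; apply/eqP.
    move/(congr1 (fun P : {poly R[i]} => P`_1)): e.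
    by rewrite coefB coefC coefZ coefX mulr1 sub0r coef0 => /eqP; rewrite oppr_eq0 => /eqP.
  move/(congr1 (fun P : {poly R[i]} => P`_0)): e.
  by rewrite coefB coefC coefZ coefX mulr0 subr0 coef0.
(* Avoiding the roots of [P1] and [P2] keeps the degrees [e1] and [e2]; avoiding those of [Q] gives
   the genericity used for the zero locus and the multiplicities. *)
have /closed_nonrootP [b] : P1 * P2 * Q != 0 by rewrite !mulf_neq0.
rewrite !rootM !negb_or => /andP [/andP [/P1b n1 /P2b n2] Qb].
have b_generic H : H \in A -> H != H0 -> s H - b * r H != 0.
  move=> HA ne; apply: contraNneq Qb => e; rewrite /root horner_prod prodf_seq_eq0.
  by apply/hasP; exists H; rewrite ?in_fsetD1 ?ne //= !hornerE mulrC e.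
have msizeE e g h : g \is e.-homog -> h \is e.-homog ->
    dehomog Z 0 g + b *: dehomog Z 0 h != 0 -> msize (dehomog Z 1 (g + b *: h)) = e.+1.
  move=> hg hh n0; apply: msize_dehomog; first by rewrite dhomogD ?dhomogZ.
  by rewrite rmorphD /= dehomogZ.
exists (dehomog Z 1 (g1 + b *: h1)), (dehomog Z 1 (g2 + b *: h2)); split.
- by have [hg hh] := log_basis_homog1 B; exact: msizeE hg hh n1.
- by have [hg hh] := log_basis_homog2 B; exact: msizeE hg hh n2.
- exact: (curves_zero_locus hA halpha hH0 hZ B b_generic).
- move=> p; exact: (curves_intersection_mult hA halpha hH0 hZ B b_generic).
Qed.
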